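(* Let $\Omega\subset\mathbb{R}^d$ ($d\ge 1$) be a connected open set with Lipschitz boundary, let $\Gamma_D,\Gamma_N$ be disjoint subsets of $\partial\Omega$ with $\partial\Omega=\Gamma_D\cup\Gamma_N$ and $\Gamma_D$ of non-zero $(d-1)$-dimensional measure, and let $\mathbf{F}\in \mathbf{L}^2(\Omega)$, $\mathbf{g}\in \mathbf{L}^2(\Gamma_N)$. Let $\mathbb{C}:\Omega\to\mathbb{R}^{d^4}$ be measurable, each $\mathbb{C}(x)$ being viewed as a linear map $\mathbb{R}^{d\times d}\to\mathbb{R}^{d\times d}$, and suppose there are $\sigma^*,\sigma_*>0$ such that, for a.e. $x\in\Omega$ and all $\boldsymbol\tau,\boldsymbol\omega\in\mathbb{R}^{d\times d}$: $\mathbb{C}(x)\boldsymbol\tau:\boldsymbol\omega=\boldsymbol\tau:\mathbb{C}(x)\boldsymbol\omega$, $(\mathbb{C}(x)\boldsymbol\tau)^T=\mathbb{C}(x)\boldsymbol\tau^T$, $|\mathbb{C}(x)|\le\sigma^*$, and $\mathbb{C}(x)\boldsymbol\tau:\boldsymbol\tau\ge\sigma_*|\boldsymbol\tau|^2$. Let $\overline{\mathbf{u}}\in \mathbf{H}^1_{\Gamma_D}(\Omega)$ be the solution of: for all $\mathbf{v}\in\mathbf{H}^1_{\Gamma_D}(\Omega)$, $$\int_\Omega \mathbb{C}\,\boldsymbol\varepsilon(\overline{\mathbf{u}}):\boldsymbol\varepsilon(\mathbf{v})\,dx=\int_\Omega\mathbf{F}\cdot\mathbf{v}\,dx+\int_{\Gamma_N}\mathbf{g}\cdot\gamma(\mathbf{v})\,dS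 .$$ If $(\mathcal D_m)_{m\in\mathbb{N}}$ is a sequence of Gradient Discretisations which is consistent, limit-conforming and coercive, and if, for each $m$, $\mathbf{u}_m\in\mathbf{X}_{\mathcal D_m,\Gamma_D}$ is the solution of the Gradient Scheme: for all $\mathbf{v}\in\mathbf{X}_{\mathcal D_m,\Gamma_D}$, $$\int_\Omega \mathbb{C}\,\boldsymbol\varepsilon_{\mathcal D_m}(\mathbf{u}_m):\boldsymbol\varepsilon_{\mathcal D_m}(\mathbf{v})\,dx=\int_\Omega\mathbf{F}\cdot\Pi_{\mathcal D_m}\mathbf{v}\,dx+\int_{\Gamma_N}\mathbf{g}\cdot\mathcal{T}_{\mathcal D_m}(\mathbf{v})\,dS,$$ then, as $m\to\infty$, $\Pi_{\mathcal D_m}\mathbf{u}_m\to\overline{\mathbf{u}}$ strongly in $\mathbf{L}^2(\Omega)$ and $\nabla_{\mathcal D_m}\mathbf{u}_m\to\nabla\overline{\mathbf{u}}$ strongly in $\mathbf{L}^2(\Omega)^d$.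
   Context: Notation: $\boldsymbol\tau:\boldsymbol\omega=\sum_{i,j}\boldsymbol\tau_{ij}\boldsymbol\omega_{ij}$ and $|\boldsymbol\tau|^2=\boldsymbol\tau:\boldsymbol\tau$ for $d\times d$ matrices; $|\mathbb{C}(x)|$ is the norm of $\mathbb{C}(x)$ as a linear map, so $|\mathbb{C}(x)\boldsymbol\tau|\le|\mathbb{C}(x)||\boldsymbol\tau|$. $\mathbf{L}^2(X)=L^2(X)^d$ (vector-valued), $\mathbf{L}^2(\Omega)^d=L^2(\Omega;\mathbb{R}^{d\times d})$ (tensor-valued), $\mathbf{H}^1(\Omega)=H^1(\Omega)^d$, $\gamma:\mathbf{H}^1(\Omega)\to\mathbf{L}^2(\partial\Omega)$ is the trace, $\mathbf{H}^1_{\Gamma_D}(\Omega)=\{\mathbf{v}\in\mathbf{H}^1(\Omega):\gamma(\mathbf{v})=0\text{ on }\Gamma_D\}$, $\nabla\mathbf{u}=(\partial_j u_i)_{i,j}$, $\boldsymbol\varepsilon(\mathbf{u})=\frac12(\nabla\mathbf{u}+(\nabla\mathbf{u})^T)$. The divergence of a tensor is taken row by row, $\operatorname{div}(\boldsymbol\tau)_i=\sum_j\partial_j\boldsymbol\tau_{ij}$. $\mathbf{H}_{\operatorname{div}}(\Omega,\Gamma_N)$ is the set of tensor fields $\boldsymbol\tau\in L^2(\Omega;\mathbb{R}^{d\times d})$ with $\operatorname{div}\boldsymbol\tau\in\mathbf{L}^2(\Omega)$ and normal trace $\gamma_{\mathbf n}(\boldsymbol\tau)\in\mathbf{L}^2(\Gamma_N)$;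 here $\gamma_{\mathbf n}(\boldsymbol\tau)\in\mathbf{H}^{-1/2}(\partial\Omega)$ is the usual normal trace, and the last condition means that its restriction to $\Gamma_N$ is an $\mathbf{L}^2$ function. A Gradient Discretisation is $\mathcal D=(\mathbf{X}_{\mathcal D,\Gamma_D},\Pi_{\mathcal D},\mathcal T_{\mathcal D},\nabla_{\mathcal D})$ where $\mathbf{X}_{\mathcal D,\Gamma_D}$ is a finite-dimensional real vector space (whose definition accounts for the null trace condition on $\Gamma_D$) and $\Pi_{\mathcal D}:\mathbf{X}_{\mathcal D,\Gamma_D}\to\mathbf{L}^2(\Omega)$, $\mathcal T_{\mathcal D}:\mathbf{X}_{\mathcal D,\Gamma_D}\to\mathbf{L}^2(\Gamma_N)$, $\nabla_{\mathcal D}:\mathbf{X}_{\mathcal D,\Gamma_D}\to\mathbf{L}^2(\Omega)^d$ are linear, with $\|\mathbf{v}\|_{\mathcal D}:=\|\nabla_{\mathcal D}\mathbf{v}\|_{\mathbf{L}^2(\Omega)^d}$ a norm on $\mathbf{X}_{\mathcal D,\Gamma_D}$. Set $\boldsymbol\varepsilon_{\mathcal D}(\mathbf{v})=\frac12(\nabla_{\mathcal D}\mathbf{v}+(\nabla_{\mathcal D}\mathbf{v})^T)$. Define $$S_{\mathcal D}(\boldsymbol\varphi)=\min_{\mathbf{v}\in\mathbf{X}_{\mathcal D,\Gamma_D}}\big\{\|\Pi_{\mathcal D}\mathbf{v}-\boldsymbol\varphi\|_{\mathbf{L}^2(\Omega)}+\|\nabla_{\mathcal D}\mathbf{v}-\nabla\boldsymbol\varphi\|_{\mathbf{L}^2(\Omega)^d}\big\},$$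 $$W_{\mathcal D}(\boldsymbol\tau)=\max_{\mathbf{v}\ne0}\frac{1}{\|\mathbf{v}\|_{\mathcal D}}\left|\int_\Omega\big(\nabla_{\mathcal D}\mathbf{v}:\boldsymbol\tau+\Pi_{\mathcal D}\mathbf{v}\cdot\operatorname{div}(\boldsymbol\tau)\big)dx-\int_{\Gamma_N}\gamma_{\mathbf n}(\boldsymbol\tau)\cdot\mathcal T_{\mathcal D}(\mathbf{v})\,dS\right|,$$ $$C_{\mathcal D}=\max_{\mathbf{v}\ne0}\max\left(\frac{\|\Pi_{\mathcal D}\mathbf{v}\|_{\mathbf{L}^2(\Omega)}}{\|\mathbf{v}\|_{\mathcal D}},\frac{\|\mathcal T_{\mathcal D}\mathbf{v}\|_{\mathbf{L}^2(\Gamma_N)}}{\|\mathbf{v}\|_{\mathcal D}}\right),\qquad K_{\mathcal D}=\max_{\mathbf{v}\ne0}\frac{\|\mathbf{v}\|_{\mathcal D}}{\|\boldsymbol\varepsilon_{\mathcal D}(\mathbf{v})\|_{\mathbf{L}^2(\Omega)^d}},$$ the maxima being over $\mathbf{v}\in\mathbf{X}_{\mathcal D,\Gamma_D}\setminus\{0\}$. A sequence $(\mathcal D_m)_{m\in\mathbb N}$ is consistent if $S_{\mathcal D_m}(\boldsymbol\varphi)\to0$ for all $\boldsymbol\varphi\in\mathbf{H}^1_{\Gamma_D}(\Omega)$; limit-conforming if $W_{\mathcal D_m}(\boldsymbol\tau)\to0$ for all $\boldsymbol\tau\in\mathbf{H}_{\operatorname{div}}(\Omega,\Gamma_N)$;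 coercive if there is $C_P>0$ with $C_{\mathcal D_m}+K_{\mathcal D_m}\le C_P$ for all $m$. *)

(* Defs.v *)
From HB Require Import structures.
From mathcomp Require Import all_boot all_order all_algebra.
From mathcomp Require Import all_classical all_reals all_analysis.
Set Implicit Arguments.
Unset Strict Implicit.
Unset Printing Implicit Defensive.
Import Order.TTheory GRing.Theory Num.Theory.
Import numFieldNormedType.Exports.
Local Open Scope classical_set_scope.
Local Open Scope ring_scope.

(* Throughout, the space dimension is d = n.+1 and R^d is 'rV[R]_n.+1.        *)
(* Vector fields take values in row vectors and tensor fields in square       *)
(* matrices; both are treated as matrix-valued functions.                     *)

Section Euclid.
Context {R : realType} {m n : nat}.

Definition mdot (A B : 'M[R]_(m, n)) : R := \sum_i \sum_j A i j * B i j.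

(* The Euclidean/Frobenius norm, as opposed to the library's max-norm `|A|. *)
Definition mnorm (A : 'M[R]_(m, n)) : R := Num.sqrt (mdot A A).

End Euclid.

Section CoverOuter.
Local Open Scope ereal_scope.
Context {R : realType} (T I : Type).

Definition cover_outer (P : set I) (s : I -> set T) (w : I -> \bar R)
    (A : set T) : \bar R :=
  ereal_inf [set \sum_(k <oo) w (F k) | F in
    [set F : nat -> I | (forall k, P (F k)) /\ A `<=` \bigcup_k s (F k)]].

Variables (P : set I) (s : I -> set T) (w : I -> \bar R) (i0 : I).
Hypotheses (w_ge0 : forall i, P i -> 0 <= w i).
Hypotheses (Pi0 : P i0) (wi0 : w i0 = 0).

Local Notation mu := (cover_outer P s w).

Lemma cover_outer_ge0 A : 0 <= mu A.
Proof.
apply: le_ereal_inf_tmp => _ [F [PF _] <-].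
by apply: nneseries_ge0 => k _ _; exact/w_ge0.
Qed.

Lemma cover_outer0 : mu set0 = 0.
Proof.
apply/eqP; rewrite eq_le cover_outer_ge0 andbT.
apply: ereal_inf_lbound; exists (fun=> i0); first by split.
by rewrite eseries0// => k _ _; rewrite wi0.
Qed.

Lemma le_cover_outer : {homo mu : A B / A `<=` B >-> A <= B}.
Proof.
move=> A B AB; apply/ereal_inf_le_tmp => _ [F [PF BF] <-].
by exists F => //; split=> //; exact: subset_trans BF.
Qed.

Lemma cover_outer_sigma_subadditive : sigma_subadditive mu.
Proof.
move=> A; have [[i ioo]|] := pselect (exists i, mu (A i) = +oo).
  rewrite (eseries_pinfty _ _ ioo) ?leey// => k _.
  by rewrite -ltNye (lt_le_trans _ (cover_outer_ge0 _)).
rewrite -forallNE => Aoo.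
suff add2e (e : {posnum R}) :
    mu (\bigcup_k A k) <= \sum_(i <oo) mu (A i) + e%:num%:E.
  by apply/lee_addgt0Pr => _/posnumP[].
rewrite (le_trans _ (epsilon_trick _ _ _))//; last first.
  by move=> k; exact: cover_outer_ge0.
pose Q k (F : nat -> I) := ((forall l, P (F l)) /\ A k `<=` \bigcup_l s (F l))
  /\ \sum_(l <oo) w (F l) <= mu (A k) + (e%:num / (2 ^ k.+1)%:R)%:E.
have [G QG] : {G : nat -> nat -> I & forall k, Q k (G k)}.
  apply: (@choice _ _ Q) => k; rewrite /Q.
  have en1 : (0 < e%:num / (2 ^ k.+1)%:R :> R)%R by [].
  have muA : mu (A k) \is a fin_num.
    by rewrite ge0_fin_numE ?cover_outer_ge0// ltey; exact/eqP/Aoo.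
  have [x [F PF <-] xS] := lb_ereal_inf_adherent en1 muA.
  by exists F; split => //; exact/ltW.
have wG_ge0 x : 0 <= (w \o uncurry G) x.
  by case: x => i j /=; apply: w_ge0; exact: (QG i).1.1.
apply: (@le_trans _ _ (\esum_(i in setT) (w \o uncurry G) i)).
  apply: ereal_inf_lbound => /=.
  have /card_esym/ppcard_eqP[f] := card_nat2.
  exists (uncurry G \o f).
    split => [i|t [i _]] /=.
      by case: (f i) => a b /=; exact: (QG a).1.1.
    move=> /(QG i).1.2[j _ Bijt]; exists (f^-1%FUN (i, j)) => //=.
    by rewrite invK ?inE.
  rewrite -(esum_pred_image (w \o uncurry G) _ xpredT) ?[fun=> _]set_true//.
  by rewrite image_eq.
rewrite (_ : esum _ _ = \sum_(i <oo) \sum_(j <oo ) w (G i j)); last first.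
  pose J : nat -> set (nat * nat) := fun i => [set (i, j) | j in setT].
  rewrite (_ : setT = \bigcup_k J k); last first.
    by rewrite predeqE => -[a b]; split => // _; exists a => //; exists b.
  rewrite esum_bigcupT /=; last 2 first.
  - apply/trivIsetP => i j _ _ ij.
    rewrite predeqE => -[a b] /=; split => //= -[] [_] _ [<-{a} _].
    by move=> [m' _] [] /esym/eqP; rewrite (negbTE ij).
  - exact: wG_ge0.
  rewrite -(image_id [set: nat]) -fun_true esum_pred_image//; last first.
    by move=> k _; apply: esum_ge0 => x _; exact: wG_ge0.
  apply: eq_eseriesr => /= j _.
  rewrite -(esum_pred_image (w \o uncurry G) (pair j) predT)/=; last 2 first.
  - by move=> k _; exact: (wG_ge0 (j, k)).
  - by move=> ? ? _ _; exact: (@can_inj _ _ _ snd).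
  by congr esum; rewrite predeqE => -[a b]; split; move=> [i _ <-]; exists i.
apply: lee_nneseries => [i _ _|i _]; last exact: (QG i).2.
by apply: nneseries_ge0 => j _ _; exact: (wG_ge0 (i, j)).
Qed.

End CoverOuter.

Section Lebesgue.
Context (R : realType) (n : nat).
Local Notation Rd := 'rV[R]_n.+1.

Definition box (c : Rd * Rd) : set Rd :=
  [set x | forall i, c.1 0 i < x 0 i <= c.2 0 i].

Definition box_vol (c : Rd * Rd) : \bar R := (\prod_i (c.2 0 i - c.1 0 i))%:E.

Definition lebesgue_outer : set Rd -> \bar R :=
  cover_outer [set c : Rd * Rd | forall i, c.1 0 i <= c.2 0 i] box box_vol.

Let vol_ge0 (c : Rd * Rd) : (forall i, c.1 0 i <= c.2 0 i) ->
  (0 <= box_vol c)%E.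
Proof.
by move=> c12; rewrite lee_fin prodr_ge0// => i _; rewrite subr_ge0.
Qed.

Let vol0 : box_vol (0, 0) = 0%E.
Proof. by rewrite /box_vol big_ord_recl/= subrr mul0r. Qed.

Let le00 : [set c : Rd * Rd | forall i, c.1 0 i <= c.2 0 i] (0, 0).
Proof. by move=> i /=. Qed.

HB.instance Definition _ := isOuterMeasure.Build R Rd lebesgue_outer
  (cover_outer0 box vol_ge0 le00 vol0) (cover_outer_ge0 box vol_ge0)
  (@le_cover_outer _ _ _ _ _ _)
  (cover_outer_sigma_subadditive box vol_ge0).

Definition leb_om : {outer_measure set Rd -> \bar R} := lebesgue_outer.

(* The domain carries the sigma-algebra of Lebesgue-measurable sets. *)
Definition leb : {measure set (caratheodory_type leb_om) -> \bar R} := leb_om.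

End Lebesgue.

Section Hausdorff.
Context (R : realType) (n : nat).
Local Notation Rd := 'rV[R]_n.+1.
Local Open Scope ereal_scope.

Fixpoint ball_vol (k : nat) : R :=
  match k with
  | 0%N => 1%R
  | 1%N => 2%R
  | k'.+2 => (2 * pi / k'.+2%:R * ball_vol k')%R
  end.

Lemma ball_vol_ge0 k : (0 <= ball_vol k)%R.
Proof.
elim/ltn_ind: k => -[|[|k]] IH //=.
by rewrite mulr_ge0 ?IH// divr_ge0// mulr_ge0// pi_ge0.
Qed.

Definition ediam (A : set Rd) : \bar R :=
  ereal_sup [set (mnorm (p.1 - p.2))%:E | p in A `*` A].

(* k is the dimension of the measure; for k = 0 every nonempty set has weight *)
(* 1, so that the 0-dimensional measure is the counting measure.              *)
Definition hausdorff_weight (k : nat) (A : set Rd) : \bar R :=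
  if pselect (A = set0) then 0
  else (ball_vol k)%:E * (ediam A * (2^-1)%:E) ^+ k.

Definition hausdorff_delta (k : nat) (delta : R) : set Rd -> \bar R :=
  cover_outer [set A | A = set0 \/ ediam A <= delta%:E] id (hausdorff_weight k).

(* Normalised so that it agrees with the usual surface measure. *)
Definition hausdorff_outer (k : nat) (A : set Rd) : \bar R :=
  ereal_sup [set hausdorff_delta k delta A | delta in [set delta | (0 < delta)%R]].

Let weight_ge0 k delta (A : set Rd) : A = set0 \/ ediam A <= delta%:E ->
  0 <= hausdorff_weight k A.
Proof.
move=> _; rewrite /hausdorff_weight; case: pselect => // A0.
rewrite mule_ge0 ?lee_fin ?ball_vol_ge0// expe_ge0// mule_ge0 ?lee_fin//.
have /set0P[x Ax] : A != set0 by exact/eqP.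
apply: le_trans (ereal_sup_ubound _); last by exists (x, x).
by rewrite lee_fin sqrtr_ge0.
Qed.

Let weight0 k : hausdorff_weight k set0 = 0.
Proof. by rewrite /hausdorff_weight; case: pselect. Qed.

Let delta0 (delta : R) : [set A : set Rd | A = set0 \/ ediam A <= delta%:E] set0.
Proof. by left. Qed.

Let haus_ge0 k A : 0 <= hausdorff_outer k A.
Proof.
apply: le_trans (ereal_sup_ubound _); last by exists 1%R => //=.
exact: (cover_outer_ge0 id (@weight_ge0 k 1)).
Qed.

Let haus0 k : hausdorff_outer k set0 = 0.
Proof.
apply/eqP; rewrite eq_le haus_ge0 andbT; apply: ge_ereal_sup => _ [d _ <-].
by rewrite /hausdorff_delta (cover_outer0 id (@weight_ge0 k d) (delta0 d)).
Qed.

Let le_haus k : {homo hausdorff_outer k : A B / A `<=` B >-> A <= B}.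
Proof.
move=> A B AB; apply: ge_ereal_sup => _ [d d0 <-].
apply: (@le_trans _ _ (hausdorff_delta k d B)); first exact: le_cover_outer.
by apply: ereal_sup_ubound; exists d.
Qed.

Let haus_subadd k : sigma_subadditive (hausdorff_outer k).
Proof.
move=> F; apply: ge_ereal_sup => _ [d d0 <-].
apply: le_trans (cover_outer_sigma_subadditive id (@weight_ge0 k d) _) _.
apply: lee_nneseries => [i _ _|i _].
  exact: (cover_outer_ge0 id (@weight_ge0 k d)).
by apply: ereal_sup_ubound; exists d.
Qed.

HB.instance Definition _ k := isOuterMeasure.Build R Rd (hausdorff_outer k)
  (haus0 k) (haus_ge0 k) (@le_haus k) (@haus_subadd k).

Definition surf_om : {outer_measure set Rd -> \bar R} := hausdorff_outer n.

(* The (d-1)-dimensional Hausdorff measure. *)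
Definition surf : {measure set (caratheodory_type surf_om) -> \bar R} := surf_om.

End Hausdorff.

Section LebesgueSpaces.
Context d (T : measurableType d) {R : realType} {p q : nat}.
Variables (mu : {measure set T -> \bar R}) (D : set T).
Implicit Types f : T -> 'M[R]_(p, q).

(* Functions are representatives: only their values on D, up to mu-negligible *)
(* sets, matter.                                                              *)
Definition L2norm f : \bar R :=
  'N[mu]_(2%:E)[(fun x => (mnorm (f x))%:E) \_ D]%E.

Definition L2 f : Prop :=
  (forall i j, measurable_fun D (fun x => f x i j)) /\ (L2norm f < +oo)%E.

End LebesgueSpaces.

Section Sobolev.
Context (R : realType) (n : nat).
Local Notation d := n.+1.
Local Notation Rd := 'rV[R]_d.
Local Notation leb := (leb R n).
Local Notation surf := (surf R n).
Implicit Types (Omega Gam K : set Rd) (phi : Rd -> R).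
Implicit Types (v t w h : Rd -> 'rV[R]_d) (G tau : Rd -> 'M[R]_d).

Definition bdry Omega : set Rd := closure Omega `\` interior Omega.

(* Around each boundary point x0, in the orthonormal coordinates y given by   *)
(* x = x0 + y Q, Omega is the part of the cylinder |y'| < r, |y_d| < l lying  *)
(* strictly below the graph y_d = eta(y') of a Lipschitz function, and the    *)
(* boundary is that graph; here y' = col' ord_max y and y_d = y 0 ord_max.    *)
Definition lipschitz_boundary Omega : Prop :=
  forall x0, bdry Omega x0 ->
  exists (Q : 'M[R]_d) (r l L : R) (eta : 'rV[R]_n -> R),
    [/\ Q *m Q^T = 1%:M, 0 < r, 0 < l,
        forall y z, `|eta y - eta z| <= L * mnorm (y - z) &
        forall y : Rd, mnorm (col' ord_max y) < r -> `|y 0 ord_max| < l ->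
          (Omega (x0 + y *m Q) <-> y 0 ord_max < eta (col' ord_max y)) /\
          (bdry Omega (x0 + y *m Q) <-> y 0 ord_max = eta (col' ord_max y))].

Definition partial (j : 'I_d) phi : Rd -> R := 'D_(delta_mx 0 j) phi.

Fixpoint Ck (k : nat) phi : Prop :=
  continuous phi /\
  if k is k'.+1 then
    forall j, (forall x, derivable phi x (delta_mx 0 j)) /\ Ck k' (partial j phi)
  else True.

Definition smooth phi : Prop := forall k, Ck k phi.

Definition test_function Omega phi : Prop :=
  smooth phi /\ exists K, [/\ compact K, K `<=` Omega & forall x, ~ K x -> phi x = 0].

Definition weak_gradient Omega v G : Prop :=
  forall phi, test_function Omega phi -> forall i j,
    Rintegral leb Omega (fun x => v x 0 i * partial j phi x) =
    - Rintegral leb Omega (fun x => G x i j * phi x).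

Definition weak_divergence Omega tau w : Prop :=
  forall phi, test_function Omega phi -> forall i,
    Rintegral leb Omega (fun x => \sum_j tau x i j * partial j phi x) =
    - Rintegral leb Omega (fun x => w x 0 i * phi x).

(* v is in H^1(Omega)^d, with gradient G. *)
Definition H1 Omega v G : Prop :=
  [/\ L2 leb Omega v, L2 leb Omega G & weak_gradient Omega v G].

(* t is the trace of v: the trace is the continuous extension to H^1 of the   *)
(* restriction to the boundary of smooth functions, so its graph is the       *)
(* closure of the graph of this restriction.                                  *)
Definition is_trace Omega v G t : Prop :=
  L2 surf (bdry Omega) t /\
  exists phi : nat -> Rd -> 'rV[R]_d,
    [/\ forall k i, test_function setT (fun x => phi k x 0 i),
        (fun k => L2norm leb Omega (fun x => phi k x - v x)) @ \oo --> 0%E,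
        (fun k => L2norm leb Omega (fun x =>
           (\matrix_(i, j) partial j (fun z => phi k z 0 i) x) - G x))
          @ \oo --> 0%E &
        (fun k => L2norm surf (bdry Omega) (fun x => phi k x - t x))
          @ \oo --> 0%E].

(* v is in H^1(Omega)^d, with gradient G and trace t, and t = 0 on Gam. *)
Definition H1_0 Omega Gam v G t : Prop :=
  [/\ H1 Omega v G, is_trace Omega v G t &
      {ae surf, forall x, Gam x -> t x = 0}].

(* The normal trace of tau, with w = div tau, evaluated at the trace of v.    *)
Definition normal_trace Omega tau w v G : R :=
  Rintegral leb Omega (fun x => mdot (tau x) (G x) + mdot (w x) (v x)).

(* tau is in H_div(Omega, Gam), with divergence w and normal trace h on Gam.  *)
(* The restriction to Gam of the functional normal_trace is its restriction   *)
(* to the traces that vanish on the rest of the boundary.                     *)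
Definition Hdiv Omega Gam tau w h : Prop :=
  [/\ L2 leb Omega tau, L2 leb Omega w, weak_divergence Omega tau w,
      L2 surf Gam h &
      forall v G t, H1_0 Omega (bdry Omega `\` Gam) v G t ->
        normal_trace Omega tau w v G =
        Rintegral surf Gam (fun x => mdot (h x) (t x))].

End Sobolev.

Section Tensors.
Context {R : realType} {d : nat}.

Definition sympart (A : 'M[R]_d) : 'M[R]_d := 2^-1 *: (A + A^T).

Definition tensor4 := 'I_d -> 'I_d -> 'I_d -> 'I_d -> R.

Definition tapp (c : tensor4) (A : 'M[R]_d) : 'M[R]_d :=
  \matrix_(i, j) \sum_k \sum_l c i j k l * A k l.

Definition opnorm (c : tensor4) : \bar R :=
  ereal_sup [set (mnorm (tapp c A))%:E | A in [set A | mnorm A <= 1]].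

End Tensors.
Arguments tensor4 : clear implicits.

(* A norm, valued in the extended reals because L2norm is. *)
Definition is_norm (R : realType) (V : lmodType R) (N : V -> \bar R) : Prop :=
  [/\ forall v, N v \is a fin_num,
      forall v, N v = 0%E -> v = 0,
      forall a v, N (a *: v) = (`|a|%:E * N v)%E &
      forall v w, (N (v + w)%R <= N v + N w)%E].

Section AeLinear.
Context d (T : measurableType d) (R : realType) (p q : nat).

(* Linearity of a map from V to (classes of) functions on D. *)
Definition ae_linear (mu : {measure set T -> \bar R}) (D : set T)
    (V : lmodType R) (f : V -> T -> 'M[R]_(p, q)) : Prop :=
  forall a v w,
    {ae mu, forall x, D x -> f (a *: v + w) x = a *: f v x + f w x}.

End AeLinear.

Section GradientDiscretisation.
Context (R : realType) (n : nat).
Local Notation Rd := 'rV[R]_n.+1.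
Local Notation leb := (leb R n).
Local Notation surf := (surf R n).

Record grad_disc (Omega GamN : set Rd) := GradDisc {
  gd_space :> vectType R;
  gd_rec : gd_space -> Rd -> 'rV[R]_n.+1;
  gd_trace : gd_space -> Rd -> 'rV[R]_n.+1;
  gd_grad : gd_space -> Rd -> 'M[R]_n.+1;
  gd_rec_L2 : forall v, L2 leb Omega (gd_rec v);
  gd_trace_L2 : forall v, L2 surf GamN (gd_trace v);
  gd_grad_L2 : forall v, L2 leb Omega (gd_grad v);
  gd_rec_linear : ae_linear leb Omega gd_rec;
  gd_trace_linear : ae_linear surf GamN gd_trace;
  gd_grad_linear : ae_linear leb Omega gd_grad;
  gd_norm_is_norm : is_norm (fun v => L2norm leb Omega (gd_grad v))
}.

Variables (Omega GamN : set Rd).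
Implicit Type D : grad_disc Omega GamN.
Local Open Scope ereal_scope.

Definition gd_norm D (v : D) : \bar R := L2norm leb Omega (gd_grad v).

Definition gd_strain D (v : D) (x : Rd) : 'M[R]_n.+1 := sympart (gd_grad v x).

(* The maximum of nonnegative quantities over v <> 0, which is 0 if the space *)
(* is reduced to 0. In the extended reals a / 0 = +oo for a > 0, so gd_K is   *)
(* +oo as soon as gd_strain v = 0 for some v <> 0.                            *)
Definition gd_max D (f : D -> \bar R) : \bar R :=
  ereal_sup ([set 0] `|` [set f v | v in [set v : D | v <> 0%R]]).

(* The minimum is attained, because D is finite-dimensional. *)
Definition gd_S D (phi : Rd -> 'rV[R]_n.+1) (G : Rd -> 'M[R]_n.+1) : \bar R :=
  ereal_inf [set L2norm leb Omega (fun x => gd_rec v x - phi x)%R +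
                 L2norm leb Omega (fun x => gd_grad v x - G x)%R
            | v in [set: D]].

Definition gd_W D (tau : Rd -> 'M[R]_n.+1) (w h : Rd -> 'rV[R]_n.+1) : \bar R :=
  gd_max (fun v : D =>
    (`| Rintegral leb Omega
          (fun x => mdot (gd_grad v x) (tau x) + mdot (gd_rec v x) (w x))
        - Rintegral surf GamN (fun x => mdot (h x) (gd_trace v x)) |)%R%:E
    / gd_norm v).

Definition gd_C D : \bar R :=
  gd_max (fun v : D => maxe (L2norm leb Omega (gd_rec v) / gd_norm v)
                            (L2norm surf GamN (gd_trace v) / gd_norm v)).

Definition gd_K D : \bar R :=
  gd_max (fun v : D => gd_norm v / L2norm leb Omega (gd_strain v)).

Implicit Type Ds : nat -> grad_disc Omega GamN.

Definition consistent (GamD : set Rd) Ds : Prop :=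
  forall phi G t, H1_0 Omega GamD phi G t ->
    (fun m => gd_S (Ds m) phi G) @ \oo --> 0.

Definition limit_conforming Ds : Prop :=
  forall tau w h, Hdiv Omega GamN tau w h ->
    (fun m => gd_W (Ds m) tau w h) @ \oo --> 0.

Definition coercive Ds : Prop :=
  exists CP : R, (0 < CP)%R /\
    forall m, gd_C (Ds m) + gd_K (Ds m) <= CP%:E.

End GradientDiscretisation.

(* Main.v *)
(* With tau := C eps(ubar), testing the weak problem with smooth compactly
   supported fields gives div tau = - F, and testing it with all of H^1_0 gives
   the normal trace g on Gamma_N; so tau is in H_div and W_D(tau) measures how
   far tau is from solving the Gradient Scheme. Subtracting the scheme, for v :=
   v0 - u with v0 nearly attaining S_D(ubar), coercivity of C yields
     sigma_lo |eps_D(v)|^2 <= (W_D(tau) + sigma_up S_D(ubar)) |v|_D,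
   and |v|_D <= K_D |eps_D(v)| bounds |v|_D by a multiple of W_D + S_D.

   The only fact about Lebesgue measure on R^d this requires is that smooth
   functions are weakly differentiable, i.e. that the integral of a partial
   derivative of a compactly supported C^1 function vanishes: it is the limit of
   the integrals of difference quotients, which vanish by translation invariance. *)
Require Import Defs.
From mathcomp Require Import all_boot all_order all_algebra.
From mathcomp Require Import all_classical all_reals all_analysis.
From mathcomp Require Import measurable_realfun ring lra.
Set Implicit Arguments.
Unset Strict Implicit.
Unset Printing Implicit Defensive.
Import Order.TTheory GRing.Theory Num.Theory.
Import numFieldNormedType.Exports.
Local Open Scope classical_set_scope.
Local Open Scope ring_scope.

(** * Square-integrable matrix fields *)

(** For [c > 0] the quadratic is evaluated at its minimiser [b / c]; for [c = 0] it is affine in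
    [t], and being nonnegative everywhere it has slope zero. *)
Lemma discriminant_le (R : realType) (a b c : R) : 0 <= c ->
  (forall t, 0 <= a - 2 * t * b + t ^+ 2 * c) -> b ^+ 2 <= a * c.
Proof.
rewrite le_eqVlt => /predU1P[<-|c0] abc.
  have [->|b0] := eqVneq b 0; first by rewrite expr0n mulr0.
  (* If [b] were nonzero, the affine function would take the value [- 1] at this point. *)
  have := abc ((a + 1) / (2 * b)).
  have -> : a - 2 * ((a + 1) / (2 * b)) * b + ((a + 1) / (2 * b)) ^+ 2 * 0 = - 1.
    by field.
  by lra.
have := abc (b / c).
have -> : a - 2 * (b / c) * b + (b / c) ^+ 2 * c = (a * c - b ^+ 2) / c.
  by field; rewrite gt_eqF.
by rewrite pmulr_lge0 ?invr_gt0// subr_ge0.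
Qed.

(** * The Frobenius inner product *)

Section FrobeniusProduct.
Context {R : realType} {m n : nat}.
Implicit Types A B C : 'M[R]_(m, n).

Lemma mdotC A B : mdot A B = mdot B A.
Proof. by apply: eq_bigr => i _; apply: eq_bigr => j _; rewrite mulrC. Qed.

Lemma mdotDl A B C : mdot (A + B) C = mdot A C + mdot B C.
Proof.
rewrite /mdot -big_split; apply: eq_bigr => i _ /=.
by rewrite -big_split; apply: eq_bigr => j _; rewrite mxE mulrDl.
Qed.

Lemma mdotZl a A B : mdot (a *: A) B = a * mdot A B.
Proof.
rewrite /mdot mulr_sumr; apply: eq_bigr => i _.
by rewrite mulr_sumr; apply: eq_bigr => j _; rewrite mxE mulrA.
Qed.

Lemma mdotNl A B : mdot (- A) B = - mdot A B.
Proof. by rewrite -scaleN1r mdotZl mulN1r. Qed.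

Lemma mdotBl A B C : mdot (A - B) C = mdot A C - mdot B C.
Proof. by rewrite mdotDl mdotNl. Qed.

Lemma mdotDr A B C : mdot C (A + B) = mdot C A + mdot C B.
Proof. by rewrite !(mdotC C) mdotDl. Qed.

Lemma mdotZr a A B : mdot A (a *: B) = a * mdot A B.
Proof. by rewrite !(mdotC A) mdotZl. Qed.

Lemma mdotBr A B C : mdot C (A - B) = mdot C A - mdot C B.
Proof. by rewrite !(mdotC C) mdotBl. Qed.

Lemma mdot_ge0 A : 0 <= mdot A A.
Proof. by rewrite sumr_ge0// => i _; rewrite sumr_ge0// => j _; rewrite -expr2 sqr_ge0. Qed.

Lemma mdot0l A : mdot 0 A = 0.
Proof. by rewrite /mdot big1// => i _; rewrite big1// => j _; rewrite mxE mul0r. Qed.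

Lemma mdot0r A : mdot A 0 = 0.
Proof. by rewrite mdotC mdot0l. Qed.

Lemma sqr_mnorm A : mnorm A ^+ 2 = mdot A A.
Proof. by rewrite sqr_sqrtr// mdot_ge0. Qed.

(** Both signs come from expanding the squared norms of [A - B] and [A + B]. This provides an
    integrable majorant for products of square-integrable fields. *)
Lemma mdot_le_half A B : `|mdot A B| <= (mdot A A + mdot B B) / 2.
Proof.
have := mdot_ge0 (A - B); have := mdot_ge0 (A + B).
rewrite !mdotBl !mdotBr !mdotDl !mdotDr (mdotC B A) ler_norml => h1 h2.
by apply/andP; split; lra.
Qed.

Lemma entry_sqr_le_mdot A i j : A i j ^+ 2 <= mdot A A.
Proof.
rewrite /mdot (bigD1 i)//= (bigD1 j)//= -expr2 -addrA lerDl addr_ge0//.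
  by rewrite sumr_ge0// => k _; rewrite -expr2 sqr_ge0.
by rewrite sumr_ge0// => k _; rewrite sumr_ge0// => l _; rewrite -expr2 sqr_ge0.
Qed.

End FrobeniusProduct.

(** * Symmetric parts and fourth-order tensors acting on matrices *)

Section SquareMatrices.
Context {R : realType} {d : nat}.
Implicit Types A B : 'M[R]_d.

Lemma mdot_tr A B : mdot A^T B^T = mdot A B.
Proof.
rewrite /mdot exchange_big; apply: eq_bigr => i _ /=.
by apply: eq_bigr => j _; rewrite !mxE.
Qed.

(** Transposing both factors preserves the product, so a symmetric [A] pairs equally with [B] and
    [B^T]. *)
Lemma mdot_sympart A B : A^T = A -> mdot A (sympart B) = mdot A B.
Proof.
move=> As; rewrite mdotZr mdotDr -[mdot A B^T]mdot_tr trmxK As.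
by lra.
Qed.

Lemma tr_sympart A : (sympart A)^T = sympart A.
Proof. by rewrite /sympart linearZ/= linearD/= trmxK addrC. Qed.

Lemma sympartB A B : sympart (A - B) = sympart A - sympart B.
Proof. by rewrite /sympart linearB/= -scalerBr; congr (_ *: _); rewrite opprD addrACA. Qed.

Lemma mdot_sympart_le A : mdot (sympart A) (sympart A) <= mdot A A.
Proof.
rewrite mdot_sympart ?tr_sympart// mdotZl mdotDl.
have := mdot_le_half A^T A; rewrite mdot_tr ler_norml => /andP[_ h].
by lra.
Qed.

Lemma tappB (c : tensor4 R d) A B : tapp c (A - B) = tapp c A - tapp c B.
Proof.
apply/matrixP => i j; rewrite !mxE -sumrB; apply: eq_bigr => k _.
by rewrite -sumrB; apply: eq_bigr => l _; rewrite !mxE mulrBr.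
Qed.

Lemma tappZ (c : tensor4 R d) a A : tapp c (a *: A) = a *: tapp c A.
Proof.
apply/matrixP => i j; rewrite !mxE mulr_sumr; apply: eq_bigr => k _.
by rewrite mulr_sumr; apply: eq_bigr => l _; rewrite !mxE mulrCA.
Qed.

(** [opnorm] is a supremum over the unit ball, so a nonzero [A] is first divided by its norm and the
    bound is scaled back by homogeneity. *)
Lemma opnorm_mdot_le (c : tensor4 R d) (s : R) A : (opnorm c <= s%:E)%E ->
  mdot (tapp c A) (tapp c A) <= s ^+ 2 * mdot A A.
Proof.
move=> cs; have [A0|A0] := eqVneq (mdot A A) 0.
  have -> : A = 0.
    apply/matrixP => i j; rewrite mxE; apply/eqP; rewrite -sqrf_eq0.
    by rewrite eq_le sqr_ge0 andbT -A0 entry_sqr_le_mdot.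
  have -> : (0 : 'M[R]_d) = 0 *: 0 by rewrite scale0r.
  by rewrite tappZ !scale0r mdot0l mulr0.
have Agt : 0 < mnorm A by rewrite sqrtr_gt0 lt_def A0 mdot_ge0.
have [s0 h] : 0 <= s /\ mnorm (tapp c ((mnorm A)^-1 *: A)) <= s.
  have h : mnorm (tapp c ((mnorm A)^-1 *: A)) <= s.
    rewrite -lee_fin (le_trans _ cs)//; apply: ereal_sup_ubound.
    exists ((mnorm A)^-1 *: A) => //=.
    rewrite {1}/mnorm mdotZl mdotZr mulrA -expr2 -sqr_mnorm -exprMn.
    by rewrite mulVf ?gt_eqF// expr1n sqrtr1.
  by split => //; apply: le_trans h; exact: sqrtr_ge0.
have : mnorm (tapp c ((mnorm A)^-1 *: A)) ^+ 2 <= s ^+ 2.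
  by rewrite ler_pXn2r ?nnegrE ?sqrtr_ge0.
rewrite sqr_mnorm tappZ mdotZl mdotZr mulrA -expr2 exprVn mulrC.
by rewrite ler_pdivrMr ?exprn_gt0// sqr_mnorm.
Qed.

End SquareMatrices.

(** * The space of square-integrable fields and its inner product *)

Section SquareIntegrable.
Context d (T : measurableType d) {R : realType}.
Variables (mu : {measure set T -> \bar R}) (D : set T) (mD : measurable D).

Lemma ae_imply (P Q : T -> Prop) : (forall x, P x -> Q x) ->
  {ae mu, forall x, D x -> P x} -> {ae mu, forall x, D x -> Q x}.
Proof. by move=> PQ; apply: filterS => x PDx Dx; exact/PQ/PDx. Qed.

(** The difference [f2 - f1] agrees almost everywhere with its absolute value, which is nonnegative
    at every point. *)
Lemma ae_le_Rintegral (f1 f2 : T -> R) :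
  mu.-integrable D (EFin \o f1) -> mu.-integrable D (EFin \o f2) ->
  {ae mu, forall x, D x -> f1 x <= f2 x} ->
  Rintegral mu D f1 <= Rintegral mu D f2.
Proof.
move=> i1 i2 f12; rewrite -subr_ge0 -RintegralB//.
have m12 : measurable_fun D (fun x => f2 x - f1 x).
  exact: (measurable_funB ((measurable_EFinP _ _).1 (measurable_int mu i2))
                          ((measurable_EFinP _ _).1 (measurable_int mu i1))).
rewrite (_ : Rintegral _ _ _ = Rintegral mu D (fun x => `|f2 x - f1 x|)).
  exact: Rintegral_ge0.
congr fine; apply: ae_eq_integral => //.
- exact/measurable_EFinP.
- by apply/measurable_EFinP; exact: measurableT_comp.
- by apply: filterS f12 => x h Dx; rewrite ger0_norm// subr_ge0 h.
Qed.

Section Fields.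
Context {p q : nat}.
Implicit Types f g h : T -> 'M[R]_(p, q).

Definition mfield f := forall i j, measurable_fun D (fun x => f x i j).

Definition L2dot f g : R := Rintegral mu D (fun x => mdot (f x) (g x)).

Lemma measurable_mdot f g : mfield f -> mfield g ->
  measurable_fun D (fun x => mdot (f x) (g x)).
Proof.
move=> mf mg; apply: measurable_sum => i; apply: measurable_sum => j.
exact: measurable_funM.
Qed.

Lemma mfieldD f g : mfield f -> mfield g -> mfield (fun x => f x + g x).
Proof.
move=> mf mg i j; under eq_fun do rewrite mxE; exact: measurable_funD.
Qed.

Lemma mfieldZ a f : mfield f -> mfield (fun x => a *: f x).
Proof.
move=> mf i j; under eq_fun do rewrite mxE; apply: measurable_funM => //.
Qed.

(** The norm integrates the extension of [mnorm f] by zero outside [D]; since the square of 0 is 0,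
    this is an integral over [D]. *)
Lemma L2normE f :
  L2norm mu D f = ((\int[mu]_(x in D) (mdot (f x) (f x))%:E) `^ 2^-1)%E.
Proof.
rewrite /L2norm unlock; congr (_ `^ _)%E.
rewrite [RHS]integral_mkcond; apply: eq_integral => x _.
rewrite /patch; case: ifPn => _ /=; last by rewrite normr0 powR0// pnatr_eq0.
by rewrite powR_mulrn// real_normK ?num_real// sqr_mnorm.
Qed.

Lemma L2_integrable f : L2 mu D f ->
  mu.-integrable D (fun x => (mdot (f x) (f x))%:E).
Proof.
move=> [mf fy]; apply/integrableP; split.
  by apply/measurable_EFinP; exact: measurable_mdot.
move: fy; rewrite L2normE => fy.
under eq_integral do rewrite gee0_abs ?lee_fin ?mdot_ge0//.
by apply: lty_poweRy fy; rewrite invr_neq0.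
Qed.

Lemma integrable_mdot f g : L2 mu D f -> L2 mu D g ->
  mu.-integrable D (fun x => (mdot (f x) (g x))%:E).
Proof.
move=> f2 g2; have fi := L2_integrable f2; have gi := L2_integrable g2.
apply: (le_integrable mD _ _ (integrableD mD fi gi)).
  by apply/measurable_EFinP; apply: measurable_mdot; [case: f2|case: g2].
move=> x _ /=; rewrite lee_fin [leRHS]ger0_norm ?addr_ge0 ?mdot_ge0//.
apply: le_trans (mdot_le_half _ _) _; have := mdot_ge0 (f x).
by have := mdot_ge0 (g x); lra.
Qed.

Lemma L2dot_ge0 f : 0 <= L2dot f f.
Proof. by apply: Rintegral_ge0 => x _; exact: mdot_ge0. Qed.

Lemma L2dotC f g : L2dot f g = L2dot g f.
Proof. by apply: eq_Rintegral => x _; rewrite mdotC. Qed.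

(** The passage from the extended-real norm to real numbers, where all the estimates are carried
    out. *)
Lemma L2norm_L2dot f : L2 mu D f -> L2norm mu D f = (Num.sqrt (L2dot f f))%:E.
Proof.
move=> f2; rewrite L2normE -[X in (X `^ _)%E]fineK.
  by rewrite poweR_EFin powR12_sqrt// L2dot_ge0.
exact: integrable_fin_num (L2_integrable f2).
Qed.

Lemma L2_from_integrable f : mfield f ->
  mu.-integrable D (fun x => (mdot (f x) (f x))%:E) -> L2 mu D f.
Proof.
move=> mf fi; split=> //; rewrite L2normE -[X in (X `^ _)%E]fineK.
  by rewrite poweR_EFin ltry.
exact: integrable_fin_num fi.
Qed.

Lemma L2dotZl a f g : L2 mu D f -> L2 mu D g ->
  L2dot (fun x => a *: f x) g = a * L2dot f g.
Proof.
move=> f2 g2; rewrite /L2dot; under eq_Rintegral do rewrite mdotZl.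
by rewrite RintegralZl//; exact: integrable_mdot.
Qed.

Lemma L2dotDl f g h : L2 mu D f -> L2 mu D g -> L2 mu D h ->
  L2dot (fun x => f x + g x) h = L2dot f h + L2dot g h.
Proof.
move=> f2 g2 h2; rewrite /L2dot; under eq_Rintegral do rewrite mdotDl.
by rewrite RintegralD//; exact: integrable_mdot.
Qed.

Lemma L2dotBl f g h : L2 mu D f -> L2 mu D g -> L2 mu D h ->
  L2dot (fun x => f x - g x) h = L2dot f h - L2dot g h.
Proof.
move=> f2 g2 h2; rewrite /L2dot; under eq_Rintegral do rewrite mdotBl.
by rewrite RintegralB//; exact: integrable_mdot.
Qed.

Lemma L2D f g : L2 mu D f -> L2 mu D g -> L2 mu D (fun x => f x + g x).
Proof.
move=> f2 g2; apply: L2_from_integrable.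
  by apply: mfieldD; [case: f2|case: g2].
have -> : (fun x => (mdot (f x + g x) (f x + g x))%:E) =
    (fun x => (mdot (f x) (f x))%:E + (2%:E * (mdot (f x) (g x))%:E +
              (mdot (g x) (g x))%:E))%E.
  apply/funext => x; rewrite -EFinM -!EFinD !mdotDl !mdotDr (mdotC (g x)).
  by congr EFin; ring.
apply: integrableD => //; first exact: L2_integrable.
apply: integrableD => //; last exact: L2_integrable.
by apply: integrableZl => //; exact: integrable_mdot.
Qed.

Lemma L2Z a f : L2 mu D f -> L2 mu D (fun x => a *: f x).
Proof.
move=> f2; apply: L2_from_integrable.
  by apply: mfieldZ; case: f2.
have -> : (fun x => (mdot (a *: f x) (a *: f x))%:E) =
    (fun x => ((a ^+ 2)%:E * (mdot (f x) (f x))%:E)%E).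
  by apply/funext => x; rewrite -EFinM mdotZl mdotZr mulrA.
by apply: integrableZl => //; exact: L2_integrable.
Qed.

Lemma L2N f : L2 mu D f -> L2 mu D (fun x => - f x).
Proof.
move=> f2; rewrite (_ : (fun x => - f x) = fun x => (-1) *: f x); first exact: L2Z.
by apply/funext => x; rewrite scaleN1r.
Qed.

Lemma L2dotNl f g : L2 mu D f -> L2 mu D g -> L2dot (fun x => - f x) g = - L2dot f g.
Proof.
move=> f2 g2; rewrite (_ : (fun x => - f x) = fun x => (-1) *: f x).
  by rewrite L2dotZl// mulN1r.
by apply/funext => x; rewrite scaleN1r.
Qed.

Lemma L2B f g : L2 mu D f -> L2 mu D g -> L2 mu D (fun x => f x - g x).
Proof.
move=> f2 g2; have -> : (fun x => f x - g x) = (fun x => f x + (-1) *: g x).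
  by apply/funext => x; rewrite scaleN1r.
by apply: L2D => //; exact: L2Z.
Qed.

(** The squared norm of [f - t *: g] is a nonnegative quadratic in [t], so [discriminant_le]
    applies. *)
Lemma cauchy_schwarz f g : L2 mu D f -> L2 mu D g ->
  `|L2dot f g| <= Num.sqrt (L2dot f f) * Num.sqrt (L2dot g g).
Proof.
move=> f2 g2; rewrite -sqrtrM ?L2dot_ge0// -sqrtr_sqr ler_wsqrtr//.
apply: discriminant_le => [|t]; first exact: L2dot_ge0.
have tg2 := L2Z t g2; have fg2 := L2B f2 tg2.
have := L2dot_ge0 (fun x => f x - t *: g x).
rewrite L2dotBl// L2dotZl// (L2dotC f) (L2dotC g) !L2dotBl// !L2dotZl// (L2dotC g f).
by move=> h; apply: le_trans h _; rewrite le_eqVlt; apply/orP; left; apply/eqP; ring.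
Qed.

Lemma L2dot_triangle f g : L2 mu D f -> L2 mu D g ->
  Num.sqrt (L2dot (fun x => f x + g x) (fun x => f x + g x)) <=
  Num.sqrt (L2dot f f) + Num.sqrt (L2dot g g).
Proof.
move=> f2 g2; have fg2 := L2D f2 g2.
rewrite -[leRHS]ger0_norm ?addr_ge0 ?sqrtr_ge0// -sqrtr_sqr ler_wsqrtr//.
rewrite sqrrD !sqr_sqrtr ?L2dot_ge0//.
rewrite L2dotDl// (L2dotC f) (L2dotC g) !L2dotDl// (L2dotC g f).
have := cauchy_schwarz f2 g2; rewrite ler_norml => /andP[_].
move: (_ * Num.sqrt _) => c; rewrite -mulr_natl => h; lra.
Qed.

Lemma eq_L2dot_ae f f' g g' : mfield f -> mfield f' -> mfield g -> mfield g' ->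
  {ae mu, forall x, D x -> f x = f' x} ->
  {ae mu, forall x, D x -> g x = g' x} -> L2dot f g = L2dot f' g'.
Proof.
move=> mf mf' mg mg' ff' gg'; congr fine; apply: ae_eq_integral => //.
- by apply/measurable_EFinP; exact: measurable_mdot.
- by apply/measurable_EFinP; exact: measurable_mdot.
- by apply: filterS2 ff' gg' => x fx gx Dx; rewrite fx// gx.
Qed.

(** The identity is asked only almost everywhere because the reconstructions of a Gradient
    Discretisation are linear only up to null sets. *)
Lemma L2dot_triangle_ae f g h : L2 mu D f -> L2 mu D g -> L2 mu D h ->
  {ae mu, forall x, D x -> f x = g x - h x} ->
  Num.sqrt (L2dot f f) <= Num.sqrt (L2dot g g) + Num.sqrt (L2dot h h).
Proof.
move=> f2 g2 h2 fgh; have Nh2 := L2N h2.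
have [mf _] := f2; have [mgh _] := L2D g2 Nh2.
rewrite (eq_L2dot_ae mf mgh mf mgh fgh fgh) (le_trans (L2dot_triangle g2 Nh2))//.
by rewrite L2dotNl// L2dotC L2dotNl// opprK.
Qed.

End Fields.

(** Serves to show that strains and stresses are square-integrable, with the constants of the
    pointwise bounds. *)
Lemma L2_le {p q p' q'} (f : T -> 'M[R]_(p, q)) (g : T -> 'M[R]_(p', q')) c :
  mfield f -> L2 mu D g ->
  {ae mu, forall x, D x -> mdot (f x) (f x) <= c * mdot (g x) (g x)} ->
  L2 mu D f /\ L2dot f f <= c * L2dot g g.
Proof.
move=> mf g2 fg; have gi := L2_integrable g2.
have cgi : mu.-integrable D (EFin \o (fun x => c * mdot (g x) (g x))).
  by apply: eq_integrable (integrableZl mD c gi) => // x _; rewrite /= EFinM.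
(* The absolute value keeps the majorant nonnegative whatever the sign of [c]. *)
have le : (\int[mu]_(x in D) (mdot (f x) (f x))%:E <=
           \int[mu]_(x in D) `|c%:E * (mdot (g x) (g x))%:E|)%E.
  apply: ae_ge0_le_integral => //.
  - by move=> x _; rewrite lee_fin mdot_ge0.
  - by apply/measurable_EFinP; exact: measurable_mdot.
  - apply: measurableT_comp => //; apply: measurable_int; exact: integrableZl gi.
  - by apply: filterS fg => x h Dx; rewrite lee_fin (le_trans (h Dx))// ler_norm.
have fi : mu.-integrable D (fun x => (mdot (f x) (f x))%:E).
  apply/integrableP; split.
    by apply/measurable_EFinP; exact: measurable_mdot.
  under eq_integral do rewrite gee0_abs ?lee_fin ?mdot_ge0//.
  apply: le_lt_trans le _.
  by have /integrableP[] := integrableZl mD c gi.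
split; first exact: L2_from_integrable.
by rewrite -RintegralZl//; exact: ae_le_Rintegral.
Qed.

End SquareIntegrable.

(** * Lebesgue measure on row vectors *)

Section LebesgueMeasure.
Context {R : realType} {n : nat}.
Local Notation Rd := 'rV[R]_n.+1.
Local Notation leb := (leb R n).
Local Notation leb_om := (leb_om R n).
Local Notation Rdm := (caratheodory_type leb_om).
Implicit Types (A X : set Rd) (c : Rd * Rd).

Let valid c := forall i, c.1 0 i <= c.2 0 i.

Lemma box_vol_ge0 c : valid c -> (0 <= box_vol c)%E.
Proof. by move=> c12; rewrite lee_fin prodr_ge0// => i _; rewrite subr_ge0. Qed.

Lemma leb_om_le_cover (F : nat -> Rd * Rd) A : (forall k, valid (F k)) ->
  A `<=` \bigcup_k box (F k) -> (leb_om A <= \sum_(k <oo) box_vol (F k))%E.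
Proof. by move=> Fv AF; apply: ereal_inf_lbound; exists F. Qed.

Lemma le_leb_om A (a : \bar R) : (forall F : nat -> Rd * Rd,
    (forall k, valid (F k)) -> A `<=` \bigcup_k box (F k) ->
    (a <= \sum_(k <oo) box_vol (F k))%E) ->
  (a <= leb_om A)%E.
Proof. by move=> h; apply: le_ereal_inf_tmp => _ [F [Fv AF] <-]; exact: h. Qed.

Lemma leb_box_lty c : valid c -> (leb (box c) < +oo)%E.
Proof.
(* A covering is an infinite sequence, so [c] is followed by degenerate boxes of volume zero. *)
move=> cv; pose F k := if k is 0%N then c else (0, 0) : Rd * Rd.
have Fv k : valid (F k) by case: k => [|k] i.
have := @leb_om_le_cover F (box c) Fv; rewrite nneseries_recl//; last first.
  by move=> k _; exact: box_vol_ge0.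
rewrite eseries0 ?adde0; last first.
  by move=> [//|k] _ _; rewrite /box_vol/= big_ord_recl subrr mul0r.
by move=> /(_ _)/le_lt_trans; apply; rewrite ?ltry// => x cx; exists 0%N.
Qed.

Let upd (v : Rd) i m : Rd := \row_j (if j == i then m else v 0 j).

Lemma measurable_half_space i a :
  measurable ([set x : Rd | x 0 i <= a] : set Rdm).
Proof.
apply: le_caratheodory_measurable => X; apply: le_leb_om => F Fv XF.
(* Cutting every covering box along the hyperplane preserves total volume. *)
pose m k := Num.max ((F k).1 0 i) (Num.min ((F k).2 0 i) a).
(* [m k] is [a] clamped to the [i]-th edge of the box: both pieces stay valid boxes, one of them
   degenerate if the hyperplane misses the box. *)
have m1 k : (F k).1 0 i <= m k by rewrite /m le_max lexx.
have m2 k : m k <= (F k).2 0 i by rewrite /m ge_max Fv ge_min lexx.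
pose F1 k := ((F k).1, upd (F k).2 i (m k)).
pose F2 k := (upd (F k).1 i (m k), (F k).2).
have F1v k : valid (F1 k).
  by move=> j; rewrite /F1 /upd/= mxE; case: eqP => [->//|_]; exact: Fv.
have F2v k : valid (F2 k).
  by move=> j; rewrite /F2 /upd/= mxE; case: eqP => [->//|_]; exact: Fv.
have -> : (\sum_(k <oo) box_vol (F k) =
    \sum_(k <oo) box_vol (F1 k) + \sum_(k <oo) box_vol (F2 k))%E.
  rewrite -nneseriesD; last 2 first.
  - by move=> k _ _; exact: box_vol_ge0.
  - by move=> k _ _; exact: box_vol_ge0.
  apply: eq_eseriesr => k _; rewrite /box_vol -EFinD; congr EFin.
  rewrite [in LHS](bigD1 i)// [X in _ = X + _](bigD1 i)// [X in _ = _ + X](bigD1 i)//=.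
  rewrite /upd !mxE eqxx.
  under [X in _ = _ * X + _]eq_bigr => j /negbTE ji do rewrite mxE ji.
  under [X in _ = _ + _ * X]eq_bigr => j /negbTE ji do rewrite mxE ji.
  by rewrite -mulrDl; congr (_ * _); ring.
apply: leeD; apply: leb_om_le_cover => // x [Xx xa].
- have [k _ Fx] := XF _ Xx; exists k => // j; have /andP[h1 h2] := Fx j.
  rewrite /F1 /upd/= h1 mxE; case: eqP => [ji|//]; rewrite ji in h2 *.
  by rewrite /m le_max le_min h2 xa orbT.
- have [k _ Fx] := XF _ Xx; exists k => // j; have /andP[h1 h2] := Fx j.
  rewrite /F2 /upd/= h2 andbT mxE; case: eqP => [ji|//]; rewrite ji in h1 *.
  move/negP : xa; rewrite -ltNge => xa.
  by rewrite /m gt_max h1 gt_min xa orbT.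
Qed.

Lemma measurable_box c : measurable (box c : set Rdm).
Proof.
have -> : box c = \bigcap_(i in [set: 'I_n.+1])
   (~` [set x : Rd | x 0 i <= c.1 0 i] `&` [set x : Rd | x 0 i <= c.2 0 i]).
  apply/seteqP; split => [x cx i _|x cx i].
    by have /andP[h1 h2] := cx i; split => //=; apply/negP; rewrite -ltNge.
  by have [/= /negP h1 h2] := cx i I; rewrite ltNge h1.
apply: fin_bigcap_measurable => // i _; apply: measurableI.
  by apply: measurableC; exact: measurable_half_space.
exact: measurable_half_space.
Qed.

(** The boxes with rational corners contained in [A] are countably many, and they cover [A]. *)
Lemma open_measurable_Rd A : open A -> measurable (A : set Rdm).
Proof.
move=> oA; pose rbox (c : 'rV[rat]_n.+1 * 'rV[rat]_n.+1) : set Rd :=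
  box (map_mx ratr c.1, map_mx ratr c.2).
have -> : A = \bigcup_c (if `[< rbox c `<=` A >] then rbox c else set0).
  apply/seteqP; split => [x Ax|x [c _]]; last by case: asboolP => [cA /cA|_ []].
  have /nbhs_ballP[e /= e0 xeA] := open_nbhs_nbhs (conj oA Ax).
  have p_ (i : 'I_n.+1) : exists p : rat, x 0 i - e < ratr p < x 0 i.
    have [|p] := @rat_in_itvoo _ (x 0 i - e) (x 0 i); first by rewrite ltrBlDr ltrDl.
    by rewrite in_itv/= => ?; exists p.
  have q_ (i : 'I_n.+1) : exists q : rat, x 0 i < ratr q < x 0 i + e.
    have [|p] := @rat_in_itvoo _ (x 0 i) (x 0 i + e); first by rewrite ltrDl.
    by rewrite in_itv/= => ?; exists p.
  have [p pP] := choice p_; have [q qP] := choice q_.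
  (* The rational corners lie within [e] of [x] on either side, in each coordinate, so the box
     contains [x] and is contained in the max-norm ball inside [A]. *)
  exists (\row_i p i, \row_i q i) => //; case: asboolP => [_ i|[]].
    rewrite /= !mxE; have /andP[_ ->] := pP i.
    by have /andP[/ltW -> _] := qP i.
  move=> y hy; apply: xeA; split => // i j; rewrite ord1.
  have := hy j; rewrite /= !mxE => /andP[py yq].
  rewrite /ball/= ltr_norml.
  have /andP[h1 h2] := pP j; have /andP[h3 h4] := qP j.
  by apply/andP; split; lra.
apply: countable_bigcupT_measurable => [|c]; first exact: countableP.
by case: asboolP => // _; exact: measurable_box.
Qed.

Lemma continuous_measurable_Rd (phi : Rd -> R) (D : set Rdm) : measurable D ->
  continuous phi -> measurable_fun D (phi : Rdm -> R).
Proof.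
move=> mD cphi; apply: measurable_funTS.
apply: (measurability _ (RGenOInfty.measurableE R)) => _ [_ [a ->] <-].
rewrite setTI; apply: open_measurable_Rd.
by move/continuousP : cphi; apply; exact: interval_open.
Qed.

(** * Translation invariance *)

Definition translate (h x : Rd) : Rd := x + h.

Lemma translateK h A : translate h @^-1` (translate (- h) @^-1` A) = A.
Proof. by rewrite -comp_preimage; apply/seteqP; split=> x; rewrite /preimage/= /translate addrK. Qed.

(** Shifting every box of a covering keeps its volume, which gives one inequality for all shifts;
    the opposite shift gives the other. *)
Lemma leb_om_translate h A : leb_om (translate h @^-1` A) = leb_om A.
Proof.
have le h' A' : (leb_om (translate h' @^-1` A') <= leb_om A')%E.
  apply: le_leb_om => F Fv AF.
  pose G k := ((F k).1 - h', (F k).2 - h').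
  have -> : (\sum_(k <oo) box_vol (F k) = \sum_(k <oo) box_vol (G k))%E.
    apply: eq_eseriesr => k _; congr EFin; apply: eq_bigr => i _.
    by rewrite !mxE; ring.
  apply: leb_om_le_cover => [k i|x /AF[k _ Fx]].
    by rewrite /G !mxE/= lerD2r; exact: Fv.
  by exists k => // i; have := Fx i; rewrite !mxE/= ltrBlDr lerBrDr.
apply/eqP; rewrite eq_le le/= -{1}(translateK (- h) A) opprK.
exact: le.
Qed.

(** By invariance of the outer measure, cutting [X] by the preimage of [A] amounts to cutting the
    shifted [X] by [A], where the Carathéodory criterion is known. *)
Lemma measurable_translate h :
  measurable_fun setT (translate h : Rdm -> Rdm).
Proof.
move=> _ A mA; rewrite setTI.
suff : caratheodory_measurable leb_om (translate h @^-1` A) by [].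
have {}mA : caratheodory_measurable leb_om A by [].
move=> X; have := mA (translate (- h) @^-1` X).
rewrite -(leb_om_translate h) translateK => ->.
rewrite -(leb_om_translate h (_ `&` A)) -(leb_om_translate h (_ `&` ~` A)).
by rewrite !preimage_setI translateK.
Qed.

(** The image of [leb] under a translation is [leb] again, so this is a change of variables. *)
Lemma integral_translate h (f : Rd -> \bar R) :
  leb.-integrable setT f ->
  (\int[leb]_x f x = \int[leb]_x f (translate h x))%E /\
  leb.-integrable setT (f \o translate h).
Proof.
move=> fi; have mt := @measurable_translate h.
have E (g : Rdm -> \bar R) :
    (\int[pushforward leb (translate h : Rdm -> Rdm)]_x g x = \int[leb]_x g x)%E.
  by congr integral; apply/funext => A; exact: leb_om_translate.
have mf := measurable_int leb fi.
have ie : leb.-integrable setT (f \o translate h).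
  apply/integrableP; split; first exact: (measurableT_comp mf mt).
  move/integrableP : (fi) => [mf' ]; rewrite -[X in (X < _)%E -> _]E.
  rewrite (ge0_integral_pushforward mt)//.
  exact: measurableT_comp.
by split => //; rewrite -[LHS]E (integral_pushforward mt mf ie).
Qed.

End LebesgueMeasure.

(** * Integrals of compactly supported functions and their partial derivatives *)

Section CompactSupport.
Context {R : realType} {n : nat}.
Local Notation Rd := 'rV[R]_n.+1.
Local Notation leb := (leb R n).
Local Notation leb_om := (leb_om R n).
Local Notation Rdm := (caratheodory_type leb_om).
Implicit Types (phi psi : Rd -> R) (K : set Rd) (j : 'I_n.+1).
Local Notation e_ j := (delta_mx 0 j : Rd).

(** The complement of [K] is open, so [phi] is zero in a whole neighbourhood of each of its
    points. *)
Lemma partial_out K phi j : compact K -> (forall x, ~ K x -> phi x = 0) ->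
  forall x, ~ K x -> partial j phi x = 0.
Proof.
move=> cK phi0 x Kx; rewrite /partial (@near_eq_derive _ _ _ _ (cst 0)).
  by rewrite derive_cst.
have oK : open (~` K).
  by apply/closed_openC/(compact_closed _ cK); exact: norm_hausdorff.
apply: filterS (open_nbhs_nbhs (conj oK Kx)) => y; exact: phi0.
Qed.

Lemma compact_support_bounded K phi : compact K -> continuous phi ->
  (forall x, ~ K x -> phi x = 0) ->
  exists2 M, 0 <= M & forall x, `|phi x| <= M.
Proof.
move=> cK cphi phi0.
have : compact (phi @` K).
  by apply: continuous_compact => //; exact: continuous_subspaceT.
move=> /compact_bounded[N [_ hN]].
exists (`|N| + 1) => [|x]; first by rewrite addr_ge0.
have [Kx|Kx] := pselect (K x); last by rewrite phi0// normr0 addr_ge0.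
by apply: hN; [rewrite ltr_pwDr// ler_norm|exists x].
Qed.

(** Contains the open ball of radius [r] in the max-norm; constants on such cubes are the integrable
    majorants used below. *)
Definition cube (r : R) : Rd * Rd := (const_mx (- r), const_mx r).

Lemma cube_out r x : ~ box (cube r) x -> r <= `|x|.
Proof.
move=> xr; rewrite leNgt; apply/negP => rx; apply: xr => i.
have : `|x 0 i| < r.
  apply: le_lt_trans rx; rewrite -[`|x|]/(mx_norm x) mx_normrE.
  by rewrite -[X in X <= _]/((fun k : 'I_1 * 'I_n.+1 => `|x k.1 k.2|) (0, i)) le_bigmax.
by rewrite ltr_norml /cube/= !mxE => /andP[-> /ltW ->].
Qed.

Lemma leb_cube_lty r : 0 <= r -> (leb (box (cube r)) < +oo)%E.
Proof.
by move=> r0; apply: leb_box_lty => i; rewrite /cube /= !mxE; lra.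
Qed.

Lemma compact_cube K : compact K ->
  exists2 r, 0 <= r & forall x, K x -> `|x| < r.
Proof.
move=> /compact_bounded[N [_ hN]]; exists (`|N| + 2) => [|x Kx].
  by rewrite addr_ge0.
have : `|x| <= `|N| + 1 by apply: hN => //; rewrite ltr_pwDr// ler_norm.
by move/le_lt_trans; apply; rewrite ltrD2l; lra.
Qed.

Lemma integrable_cube_cst r M : 0 <= r ->
  leb.-integrable setT (EFin \o ((cst M : Rdm -> R) \_ (box (cube r)))).
Proof.
move=> r0; rewrite -restrict_EFin.
apply/(integrable_mkcond _ (measurable_box (cube r))).1.
apply: measurable_bounded_integrable => //.
- exact: measurable_box.
- exact: leb_cube_lty.
- by exists `|M|; split => // N MN x _; exact: ltW.
Qed.

Lemma integrable_compact_support K phi : compact K -> continuous phi ->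
  (forall x, ~ K x -> phi x = 0) ->
  leb.-integrable setT (EFin \o (phi : Rdm -> R)).
Proof.
move=> cK cphi phi0; have [r r0 Kr] := compact_cube cK.
have [M M0 phiM] := compact_support_bounded cK cphi phi0.
apply: (le_integrable measurableT _ _ (integrable_cube_cst M r0)).
  by apply/measurable_EFinP; exact: continuous_measurable_Rd.
move=> x _; rewrite /patch /= lee_fin; case: ifPn => [_|].
  by rewrite (ger0_norm M0).
move=> /negP; rewrite inE => /cube_out xr; rewrite phi0 ?normr0//.
by move=> /Kr; rewrite ltNge xr.
Qed.

(** Reduces a partial derivative to an ordinary one, so that the one-variable mean value theorem
    applies. The two difference quotients are the same function of [h]. *)
Lemma is_derive_line phi j (x : Rd) (t : R) :
  (forall y, derivable phi y (e_ j)) ->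
  is_derive t 1 (fun s : R => phi (x + s *: e_ j)) (partial j phi (x + t *: e_ j)).
Proof.
move=> dphi.
have E : (fun h : R => h^-1 *: (phi (x + (h *: (1 : R) + t) *: e_ j) - phi (x + t *: e_ j)))
   = (fun h => h^-1 *: (phi (h *: e_ j + (x + t *: e_ j)) - phi (x + t *: e_ j))).
  apply/funext => h; congr (_ *: (phi _ - _)).
  by rewrite scalerDl -[h *: 1]/(h * 1) mulr1 addrCA addrA.
apply: DeriveDef.
  by rewrite /derivable; move: (dphi (x + t *: e_ j)); rewrite /derivable -E.
by rewrite /partial /derive -E.
Qed.

Lemma norm_delta_le1 j : `|e_ j| <= 1.
Proof.
rewrite -[`|_|]/(mx_norm _) mx_normrE; apply: bigmax_le => // -[i k] _.
by rewrite mxE/=; case: (_ && _); rewrite ?normr1 ?normr0.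
Qed.

Lemma increment_le phi j M (x : Rd) h : 0 < h -> continuous phi ->
  (forall y, derivable phi y (e_ j)) -> (forall y, `|partial j phi y| <= M) ->
  `|h^-1 * (phi (x + h *: e_ j) - phi x)| <= M.
Proof.
move=> h0 cphi dphi phiM.
have [||c _] := @MVT R (fun s => phi (x + s *: e_ j))
    (fun t => partial j phi (x + t *: e_ j)) 0 h h0.
- by move=> t _; exact: is_derive_line.
- apply: derivable_within_continuous => t _.
  exact: (@ex_derive _ _ _ _ _ _ _ (is_derive_line x t dphi)).
rewrite scale0r addr0 subr0 => ->.
by rewrite mulrCA mulVf ?gt_eqF// mulr1.
Qed.

(** The limit is taken by dominated convergence: the mean value theorem bounds every quotient [g k]
    by a bound [M] of the partial derivative, and steps of length at most 1 keep all the supports in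
    one cube. *)
Lemma integral_partial_eq0 K phi j : compact K -> continuous phi ->
  (forall x, ~ K x -> phi x = 0) -> (forall x, derivable phi x (e_ j)) ->
  continuous (partial j phi) -> Rintegral leb setT (partial j phi) = 0.
Proof.
move=> cK cphi phi0 dphi cdphi.
have dphi0 := partial_out j cK phi0.
have [M M0 dphiM] := compact_support_bounded cK cdphi dphi0.
have [r r0 Kr] := compact_cube cK.
have phii := integrable_compact_support cK cphi phi0.
pose h k : R := k.+1%:R^-1.
have h0 k : 0 < h k by rewrite invr_gt0.
have h1 k : h k <= 1 by rewrite invf_le1// ler1n.
pose g k (x : Rd) := (h k)^-1 * (phi (x + h k *: e_ j) - phi x).
have ti k := integral_translate (h k *: e_ j) phii.
have gi k : (\int[leb]_x (g k x)%:E = 0)%E.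
  have [E ii] := ti k.
  rewrite /g; under eq_integral do rewrite EFinM.
  have di : leb.-integrable setT
      (fun x : Rdm => (phi (x + h k *: e_ j) - phi x)%:E).
    by apply: eq_integrable (integrableB measurableT ii phii).
  rewrite integralZl//.
  under eq_integral do rewrite EFinB.
  rewrite integralB// -E subee ?mule0//.
  exact: integrable_fin_num phii.
have mg k : measurable_fun setT (EFin \o (g k : Rdm -> R)).
  apply/measurable_EFinP; apply: (measurable_funM (measurable_cst _)).
  apply: measurable_funB; last exact: continuous_measurable_Rd.
  exact: (measurable_EFinP _ _).1 (measurable_int leb (ti k).2).
have [] := @dominated_convergence _ Rdm R leb setT measurableT
  (fun k => EFin \o g k) (EFin \o partial j phi)
  (EFin \o ((cst M : Rdm -> R) \_ (box (cube (r + 1))))) mg _ _ _ _.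
- by apply/measurable_EFinP; exact: continuous_measurable_Rd.
- apply: aeW => x _; apply: cvg_EFin; first exact: nearW.
  (* The derivative is a limit along punctured neighbourhoods of 0, which the steps respect because
     they are never 0. *)
  have h_cvg : h @ \oo --> 0^'.
    move=> A /= A0.
    have : \forall k \near \oo, h k != 0 -> A (h k) := @cvg_harmonic R _ A0.
    by apply: filterS => k; apply; rewrite gt_eqF.
  have := cvg_comp _ _ h_cvg (dphi x); apply: cvg_trans; apply: near_eq_cvg.
  by apply: nearW => k; rewrite /g /= [_ + x]addrC.
- by apply: integrable_cube_cst; rewrite addr_ge0.
- apply: aeW => x k _ /=; rewrite lee_fin /patch; case: ifPn => [_|].
    exact: increment_le.
  (* Outside the cube of radius [r + 1], neither [x] nor [x + h k *: e_ j] can lie in [K]. *)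
  move=> /negP; rewrite inE => /cube_out xr; rewrite /g !phi0 ?subrr ?mulr0 ?normr0//.
    by move=> /Kr; rewrite ltNge (le_trans _ xr)// lerDl.
  move=> /Kr; rewrite ltNge => /negP; apply.
  have := ler_normB (x + h k *: e_ j) (h k *: e_ j); rewrite addrK => xh.
  have : `|h k *: e_ j| <= 1.
    by rewrite normrZ (ger0_norm (ltW (h0 k))) mulr_ile1 ?(ltW (h0 k))// norm_delta_le1.
  by move=> e1; move: xr xh e1; lra.
move=> _ _; rewrite (_ : [sequence _]_n = cst 0%E); last first.
  by apply/funext => k; exact: gi.
move=> /(cvg_lim (@ereal_hausdorff R)); rewrite lim_cst// => E.
by rewrite /Rintegral -E.
Qed.

End CompactSupport.

(** * Test functions *)

Lemma L2norm_eq0 d (T : measurableType d) (R : realType) (p q : nat)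
    (mu : {measure set T -> \bar R}) (D : set T) (f : T -> 'M[R]_(p, q)) :
  (forall x, D x -> f x = 0) -> L2norm mu D f = 0%E.
Proof.
move=> f0; rewrite /L2norm (_ : patch _ _ _ = cst 0%E).
  by rewrite Lnorm0// eqe pnatr_eq0.
apply/funext => x; rewrite /patch; case: ifPn => //; rewrite inE => /f0 ->.
by rewrite /mnorm mdot0l sqrtr0.
Qed.

Lemma L2_entries d (T : measurableType d) (R : realType) (p q : nat)
    (mu : {measure set T -> \bar R}) (D : set T) (f : T -> 'M[R]_(p, q)) :
  measurable D -> mfield D f ->
  (forall i j, mu.-integrable D (fun x => (f x i j * f x i j)%:E)) ->
  L2 mu D f.
Proof.
move=> mD mf fi; apply: L2_from_integrable => //.
rewrite /mdot; under eq_fun do rewrite -sumEFin.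
apply: integrable_sum => // i _; under eq_fun do rewrite -sumEFin.
by apply: integrable_sum => // j _; exact: fi.
Qed.

Section TestFunctions.
Context {R : realType} {n : nat}.
Local Notation Rd := 'rV[R]_n.+1.
Local Notation leb := (leb R n).
Local Notation surf := (surf R n).
Local Notation leb_om := (leb_om R n).
Local Notation Rdm := (caratheodory_type leb_om).
Implicit Types (phi psi : Rd -> R) (K Omega Gam : set Rd) (j : 'I_n.+1).
Implicit Types (v : Rd -> Rd).

Lemma continuous_mulf phi psi : continuous phi -> continuous psi ->
  continuous (fun x => phi x * psi x).
Proof. by move=> cphi cpsi x; apply: continuousM; [exact: cphi|exact: cpsi]. Qed.

Lemma continuous_addf phi psi : continuous phi -> continuous psi ->
  continuous (fun x => phi x + psi x).
Proof. by move=> cphi cpsi x; apply: continuousD; [exact: cphi|exact: cpsi]. Qed.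

Lemma smooth_continuous phi : smooth phi -> continuous phi.
Proof. by move=> /(_ 0%N)[]. Qed.

Lemma smooth_derivable phi j x : smooth phi -> derivable phi x (delta_mx 0 j).
Proof. by move=> /(_ 1%N)[_ /(_ j)[]]. Qed.

Lemma smooth_partial phi j : smooth phi -> smooth (partial j phi).
Proof. by move=> sphi k; have [_ /(_ j)[]] := sphi k.+1. Qed.

Lemma test_function_supp Omega phi : test_function Omega phi ->
  forall x, ~ Omega x -> phi x = 0.
Proof. by move=> [_ [K [_ KO phi0]]] x Ox; apply: phi0 => /KO. Qed.

Lemma test_function_partial Omega phi j :
  test_function Omega phi -> test_function Omega (partial j phi).
Proof.
move=> [sphi [K [cK KO phi0]]]; split; first exact: smooth_partial.
by exists K; split => //; exact: partial_out.
Qed.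

Lemma test_function0 Omega : test_function Omega (fun=> 0).
Proof.
split; last first.
  by exists set0; split => //; exact: compact0.
elim=> [|k IH]; split => //; try exact: cst_continuous.
move=> j; split=> [x|]; first exact: derivable_cst.
rewrite (_ : partial _ _ = fun=> 0)//.
by apply/funext => x; exact: derive_cst.
Qed.

Lemma Rintegral_supp Omega (f : Rd -> R) : (forall x, ~ Omega x -> f x = 0) ->
  Rintegral leb Omega f = Rintegral leb setT f.
Proof.
move=> f0; rewrite Rintegral_mkcond; congr Rintegral; apply/funext => x.
by rewrite /patch; case: ifPn => // /negP; rewrite inE => /f0.
Qed.

Lemma test_function_integrable Omega phi psi : test_function Omega phi ->
  continuous psi -> leb.-integrable setT (fun x : Rdm => (phi x * psi x)%:E).
Proof.
move=> [sphi [K [cK KO phi0]]] cpsi.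
apply: (integrable_compact_support cK) => [x|x Kx]; last by rewrite phi0// mul0r.
by apply: continuousM; [exact: smooth_continuous|exact: cpsi].
Qed.

(** The product [phi * psi] is compactly supported, so its partial derivative has integral zero; the
    product rule splits it into the two integrands, which vanish outside [Omega]. *)
Lemma integration_by_parts_test Omega phi psi j :
  test_function Omega phi -> smooth psi ->
  Rintegral leb Omega (fun x => phi x * partial j psi x) =
  - Rintegral leb Omega (fun x => partial j phi x * psi x).
Proof.
move=> tphi spsi; have tdphi := test_function_partial j tphi.
rewrite !Rintegral_supp; last 2 first.
- by move=> x Ox; rewrite (test_function_supp tdphi) ?mul0r.
- by move=> x Ox; rewrite (test_function_supp tphi) ?mul0r.
apply/eqP; rewrite -addr_eq0 -RintegralD//; last 2 first.
- by apply: (test_function_integrable tphi); apply/smooth_continuous/smooth_partial.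
- by apply: (test_function_integrable tdphi); exact/smooth_continuous.
have [sphi [K [cK KO phi0]]] := tphi.
have dE x : partial j (fun y => phi y * psi y) x =
    phi x * partial j psi x + partial j phi x * psi x.
  rewrite /partial deriveM; try exact: smooth_derivable.
  by rewrite [in RHS]addrC /GRing.scale/= [psi x * _]mulrC addrC.
rewrite (_ : Rintegral _ _ _ = Rintegral leb setT (partial j (fun y => phi y * psi y))).
  apply/eqP; apply: (integral_partial_eq0 cK).
  - move=> x; apply: continuousM; exact: smooth_continuous.
  - by move=> x Kx; rewrite phi0// mul0r.
  - by move=> x; apply: derivableM; exact: smooth_derivable.
  - rewrite (_ : partial j _ = fun x => phi x * partial j psi x + partial j phi x * psi x).
      have cdphi := smooth_continuous (smooth_partial j sphi).
      have cdpsi := smooth_continuous (smooth_partial j spsi).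
      have cphi := smooth_continuous sphi.
      have cpsi := smooth_continuous spsi.
      exact: (continuous_addf (continuous_mulf cphi cdpsi)
                              (continuous_mulf cdphi cpsi)).
    exact/funext.
by congr Rintegral; apply/funext.
Qed.

Definition grad v (x : Rd) : 'M[R]_n.+1 :=
  \matrix_(i, j) partial j (fun z => v z 0 i) x.

Lemma test_field_L2 p q Omega (f : Rd -> 'M[R]_(p, q)) : open Omega ->
  (forall i k, test_function Omega (fun x => f x i k)) -> L2 leb Omega f.
Proof.
move=> oO tf; have mO : measurable (Omega : set Rdm) := open_measurable_Rd oO.
apply: L2_entries; first exact: mO.
  move=> i j; apply: continuous_measurable_Rd; first exact: mO.
  by apply: smooth_continuous; case: (tf i j).
move=> i j; apply: (integrableS measurableT mO (@subsetT _ _)).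
apply: (test_function_integrable (tf i j)).
by apply: smooth_continuous; case: (tf i j).
Qed.

(** The constant sequence [v] serves as the approximation that defines the trace; the trace is zero
    because the open set [Omega] does not meet its boundary. *)
Lemma test_field_H1_0 Omega Gam v : open Omega ->
  (forall i, test_function Omega (fun x => v x 0 i)) ->
  H1_0 Omega Gam v (grad v) (fun=> 0).
Proof.
move=> oO tv; split; last by apply: aeW.
  split.
  - by apply: test_field_L2 => // i j; rewrite ord1.
  - apply: test_field_L2 => // i j; under eq_fun do rewrite mxE.
    exact: test_function_partial.
  - move=> phi [sphi _] i j; rewrite integration_by_parts_test//.
    by congr (- _); apply: eq_Rintegral => x _; rewrite mxE.
split.
  split=> [i j|]; last by rewrite L2norm_eq0.
  exact: measurable_cst.
exists (fun=> v); split.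
- move=> _ i; have [sv [K [cK _ v0]]] := tv i.
  by split=> //; exists K.
- by rewrite L2norm_eq0 => [|x _]; [exact: cvg_cst|rewrite subrr].
- by rewrite L2norm_eq0 => [|x _]; [exact: cvg_cst|rewrite subrr].
- rewrite L2norm_eq0 => [|x [_ Ox]]; first exact: cvg_cst.
  apply/matrixP => i j; rewrite !mxE oppr0 addr0 ord1 (test_function_supp (tv j))//.
  by move=> Omx; apply: Ox; exact: open_nbhs_nbhs (conj oO Omx).
Qed.

End TestFunctions.

(** * Linear elasticity *)

Section Ereal.
Context {R : realType}.

(** Turns bounds on [gd_C], [gd_K] and [gd_W] into inequalities between reals. For [y = 0] the
    inverse is [+oo], so a finite bound on the quotient forces [x = 0]. *)
Lemma lee_div_EFin (x y c : R) : 0 <= x -> 0 <= y ->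
  (x%:E / y%:E <= c%:E)%E -> x <= c * y.
Proof.
rewrite le_eqVlt => /predU1P[<-|x0].
  rewrite le_eqVlt => /predU1P[<-|y0]; first by rewrite mulr0.
  rewrite mul0e lee_fin => c0; rewrite mulr_ge0// ltW//.
rewrite le_eqVlt => /predU1P[<-|y0].
  by rewrite inver eqxx gt0_muley ?lte_fin// leye_eq.
by rewrite inver gt_eqF// -EFinM lee_fin ler_pdivrMr.
Qed.

Lemma near_lt_EFin (a : nat -> \bar R) (e : R) : 0 < e ->
  a @ \oo --> 0%E -> \forall m \near \oo, (a m < e%:E)%E.
Proof.
move=> e0 a0; apply: (a0 [set x | (x < e%:E)%E]) => /=.
have : nbhs (0 : R) [set x | x < e] by exact: lt_nbhsl.
by apply: filterS => x /=; rewrite lte_fin.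
Qed.

Lemma cvge0_le (a : nat -> \bar R) : (forall m, (0 <= a m)%E) ->
  (forall e : R, 0 < e -> \forall m \near \oo, (a m <= e%:E)%E) ->
  a @ \oo --> 0%E.
Proof.
move=> a0 ae A /= A0.
have /nbhs_ballP[e /= e0 eA] : nbhs (0 : R) [set r | A r%:E] := A0.
have e20 : 0 < e / 2 by rewrite divr_gt0.
apply: filterS (ae _ e20) => m ame; suff : A (a m) by [].
case: (a m) (a0 m) ame => [r| |]//; rewrite !lee_fin => r0 re; apply: eA.
by rewrite /ball/= sub0r normrN ger0_norm//; lra.
Qed.

End Ereal.

(** * Measurability and integrability of strains and stresses *)

Section TensorFields.
Context d (T : measurableType d) {R : realType} {k : nat}.
Variables (mu : {measure set T -> \bar R}) (D : set T) (mD : measurable D).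
Implicit Types (G : T -> 'M[R]_k) (c : T -> tensor4 R k).

Lemma mfield_sympart G : mfield D G -> mfield D (fun x => sympart (G x)).
Proof.
move=> mG i j; under eq_fun do rewrite !mxE.
by apply: (measurable_funM (measurable_cst _)); apply: measurable_funD.
Qed.

Lemma mfield_tapp c G :
  (forall i j p q, measurable_fun D (fun x => c x i j p q)) -> mfield D G ->
  mfield D (fun x => tapp (c x) (G x)).
Proof.
move=> mc mG i j; under eq_fun do rewrite mxE.
apply: measurable_sum => p; apply: measurable_sum => q.
exact: measurable_funM.
Qed.

Lemma L2_sympart G : L2 mu D G ->
  L2 mu D (fun x => sympart (G x)) /\
  L2dot mu D (fun x => sympart (G x)) (fun x => sympart (G x)) <= L2dot mu D G G.
Proof.
move=> G2; rewrite -[X in _ <= X]mul1r; apply: L2_le => //.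
  by apply: mfield_sympart; case: G2.
by apply: aeW => x _; rewrite mul1r mdot_sympart_le.
Qed.

Lemma L2dot_sympart S G : L2 mu D S -> L2 mu D G ->
  {ae mu, forall x, D x -> (S x)^T = S x} ->
  L2dot mu D S (fun x => sympart (G x)) = L2dot mu D S G.
Proof.
move=> [mS _] [mG _] sS; congr fine; apply: ae_eq_integral => //.
- by apply/measurable_EFinP; apply: measurable_mdot => //; exact: mfield_sympart.
- by apply/measurable_EFinP; exact: measurable_mdot.
- by apply: filterS sS => x sx Dx; rewrite mdot_sympart// sx.
Qed.

End TensorFields.

(** * Elementary properties of the quantities attached to a Gradient Discretisation *)

Section GradDisc.
Context {R : realType} {n : nat} {Omega GamN : set 'rV[R]_n.+1}.
Variable D : grad_disc Omega GamN.
Local Open Scope ereal_scope.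

Lemma gd_max_ge0 (f : D -> \bar R) : 0 <= gd_max f.
Proof. by apply: ereal_sup_ubound; left. Qed.

Lemma le_gd_max (f : D -> \bar R) (v : D) : v <> 0%R -> f v <= gd_max f.
Proof. by move=> v0; apply: ereal_sup_ubound; right; exists v. Qed.

Lemma gd_norm0 : gd_norm (0%R : D) = 0.
Proof.
have [_ _ NZ _] := gd_norm_is_norm D.
by have := NZ 0%R 0%R; rewrite scale0r normr0 mul0e.
Qed.

Lemma gd_CK_le (c : R) : gd_C D + gd_K D <= c%:E ->
  gd_C D <= c%:E /\ gd_K D <= c%:E.
Proof.
move=> h; split; apply: le_trans h.
  by rewrite leeDl// gd_max_ge0.
by rewrite leeDr// gd_max_ge0.
Qed.

End GradDisc.

(** * The stress field and its bounds *)

Section Elasticity.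
Context {R : realType} {n : nat}.
Local Notation Rd := 'rV[R]_n.+1.
Local Notation leb := (leb R n).
Local Notation surf := (surf R n).
Variables (Omega GamN GamD : set Rd) (oO : open Omega).
Variables (C : Rd -> tensor4 R n.+1) (sigma_up sigma_lo : R).
Hypothesis mC : forall i j k l,
  measurable_fun (Omega : set (caratheodory_type (leb_om R n)))
                     (fun x => C x i j k l).
Hypothesis sup0 : 0 < sigma_up.
Hypothesis slo0 : 0 < sigma_lo.
Hypothesis aeC : {ae leb, forall x, Omega x -> forall tau omega : 'M[R]_n.+1,
    [/\ mdot (tapp (C x) tau) omega = mdot tau (tapp (C x) omega),
        (tapp (C x) tau)^T = tapp (C x) tau^T,
        (opnorm (C x) <= sigma_up%:E)%E &
        sigma_lo * mnorm tau ^+ 2 <= mdot (tapp (C x) tau) tau]}.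
Implicit Types G : Rd -> 'M[R]_n.+1.

Let mO : measurable (Omega : set (caratheodory_type (leb_om R n))) :=
  open_measurable_Rd oO.

(** [G] stands for a displacement gradient, continuous or discrete, so that [stress Gubar] and
    [stress (gd_grad u)] are treated alike. *)
Definition stress G (x : Rd) : 'M[R]_n.+1 := tapp (C x) (sympart (G x)).
Definition strain G (x : Rd) : 'M[R]_n.+1 := sympart (G x).

Local Notation L2dotO := (L2dot leb Omega).
Local Notation nrm f := (Num.sqrt (L2dotO f f)).

Lemma L2_strain G : L2 leb Omega G ->
  L2 leb Omega (strain G) /\ nrm (strain G) <= nrm G.
Proof.
by move=> G2; have [e2 le] := L2_sympart mO G2; split=> //; rewrite ler_wsqrtr.
Qed.

Lemma L2_stress G : L2 leb Omega G ->
  L2 leb Omega (stress G) /\ nrm (stress G) <= sigma_up * nrm G.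
Proof.
move=> G2; have [e2 le] := L2_sympart mO G2.
have [||s2 sle] := @L2_le _ _ _ leb Omega mO _ _ _ _ (stress G) (strain G) (sigma_up ^+ 2) _ e2.
- exact: mfield_tapp mC e2.1.
- by apply: ae_imply aeC => x Cx; apply: opnorm_mdot_le; have [] := Cx 0 0.
split => //; rewrite -[X in X * _](gtr0_norm sup0) -sqrtr_sqr -sqrtrM ?sqr_ge0//.
by rewrite ler_wsqrtr// (le_trans sle)// ler_wpM2l// sqr_ge0.
Qed.

Lemma tr_stress G :
  {ae leb, forall x, Omega x -> (stress G x)^T = stress G x}.
Proof.
apply: ae_imply aeC => x Cx; have [_ + _ _] := Cx (strain G x) 0.
by rewrite /stress => ->; rewrite tr_sympart.
Qed.

Lemma stress_coercive G : L2 leb Omega G ->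
  sigma_lo * L2dotO (strain G) (strain G) <= L2dotO (stress G) (strain G).
Proof.
move=> G2; have [e2 _] := L2_strain G2; have [s2 _] := L2_stress G2.
rewrite -RintegralZl//; last exact: integrable_mdot.
apply: ae_le_Rintegral => //; last 2 first.
- exact: integrable_mdot.
- by apply: ae_imply aeC => x Cx; rewrite -sqr_mnorm; have [] := Cx (strain G x) 0.
have ei := integrableZl mO sigma_lo (integrable_mdot mO e2 e2).
by apply: eq_integrable ei => // x _; rewrite /= EFinM.
Qed.

(** The stress is symmetric, so it does not see the antisymmetric part of [H]. This passes from the
    elastic form to the products with full gradients in [gd_W] and [normal_trace]. *)
Lemma L2dot_stress G H : L2 leb Omega G -> L2 leb Omega H ->
  L2dotO (stress G) (strain H) = L2dotO (stress G) H.
Proof.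
by move=> G2 H2; exact: (L2dot_sympart mO (L2_stress G2).1 H2 (tr_stress G)).
Qed.

Lemma stress_Hdiv F g (ubar tubar : Rd -> Rd) Gubar :
  L2 leb Omega F -> L2 surf GamN g ->
  GamD `&` GamN = set0 -> bdry Omega = GamD `|` GamN ->
  H1_0 Omega GamD ubar Gubar tubar ->
  (forall v Gv tv, H1_0 Omega GamD v Gv tv ->
    Rintegral leb Omega
      (fun x => mdot (tapp (C x) (sympart (Gubar x))) (sympart (Gv x))) =
    Rintegral leb Omega (fun x => mdot (F x) (v x)) +
    Rintegral surf GamN (fun x => mdot (g x) (tv x))) ->
  Hdiv Omega GamN (stress Gubar) (fun x => - F x) g.
Proof.
move=> F2 g2 DN0 bDN ubarH weak.
have [[_ G2 _] _ _] := ubarH; have [s2 _] := L2_stress G2.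
have NF2 := L2N mO F2.
split => //.
(* The field with [phi] as its only nonzero component isolates the [i]-th row of the divergence; its
   trace is zero, so the term with [g] drops out. *)
- move=> phi tphi i; pose v (x : Rd) : Rd := \row_k (if k == i then phi x else 0).
  have tv k : test_function Omega (fun x => v x 0 k).
    rewrite (_ : (fun x => v x 0 k) = if k == i then phi else fun=> 0).
      by case: ifPn => // _; exact: test_function0.
    by apply/funext => x; rewrite mxE; case: ifPn.
  have vH := test_field_H1_0 GamD oO tv.
  have [[v2 dv2 _] _ _] := vH.
  have := weak _ _ _ vH.
  rewrite [X in _ + X](_ : _ = 0); last first.
    under eq_Rintegral do rewrite mdot0r.
    by rewrite /Rintegral integral0.
  rewrite addr0 -[LHS]/(L2dotO (stress Gubar) (strain (grad v))) L2dot_stress// => E.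
  have dE x : \sum_j stress Gubar x i j * partial j phi x =
              mdot (stress Gubar x) (grad v x).
    rewrite /mdot [RHS](bigD1 i)//= [X in _ = _ + X]big1 ?addr0 => [|k ki].
      apply: eq_bigr => j _; rewrite [grad _ _ _ _]mxE; congr (_ * partial j _ x).
      by apply/funext => z; rewrite mxE eqxx.
    rewrite big1// => j _; rewrite [grad _ _ _ _]mxE.
    rewrite (_ : (fun z => v z 0 k) = cst 0) ?/partial ?derive_cst ?mulr0//.
    by apply/funext => z; rewrite mxE (negbTE ki).
  have FE x : mdot (- F x) (v x) = (- F x) 0 i * phi x.
    rewrite /mdot big_ord1 (bigD1 i)//= big1 ?addr0 => [|k ki].
      by rewrite [v x 0 i]mxE eqxx.
    by rewrite [v x 0 k]mxE (negbTE ki) mulr0.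
  transitivity (L2dotO (stress Gubar) (grad v)); first exact: eq_Rintegral.
  rewrite E -[LHS]/(L2dotO F v) -[LHS]opprK -(L2dotNl mO F2 v2); congr (- _).
  exact: eq_Rintegral.
(* The fields that test the normal trace on [GamN] vanish on the rest of the boundary, which is
   [GamD]; so they are admissible in the weak problem. *)
- move=> v G t vH; rewrite (_ : bdry Omega `\` GamN = GamD) in vH; last first.
    rewrite bDN setDUl setDv setU0; apply/setDidPl; exact: DN0.
  have [[v2 dv2 _] _ _] := vH.
  have := weak _ _ _ vH.
  rewrite -[X in X = _ -> _]/(L2dotO (stress Gubar) (strain G)) L2dot_stress// => E.
  rewrite /normal_trace RintegralD; last 3 first.
  - exact: mO.
  - exact: (integrable_mdot mO s2 dv2).
  - exact: (integrable_mdot mO NF2 v2).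
  rewrite -[X in X + _]/(L2dotO (stress Gubar) G) E.
  rewrite -[X in _ + X]/(L2dotO (fun x => - F x) v) (L2dotNl mO F2 v2).
  by rewrite -[X in X + _ + _]/(L2dotO F v); ring.
Qed.

(** * Error estimate for a single Gradient Discretisation *)

Variables (F g ubar : Rd -> Rd) (Gubar : Rd -> 'M[R]_n.+1).
Hypothesis F2 : L2 leb Omega F.
Hypotheses (ubar2 : L2 leb Omega ubar) (Gubar2 : L2 leb Omega Gubar).

Variables (D : grad_disc Omega GamN) (u : D) (CP : R).
Hypothesis CP0 : 0 < CP.
Hypothesis coerD : (gd_C D + gd_K D <= CP%:E)%E.
Hypothesis scheme : forall v : D,
    Rintegral leb Omega
      (fun x => mdot (tapp (C x) (gd_strain u x)) (gd_strain v x)) =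
    Rintegral leb Omega (fun x => mdot (F x) (gd_rec v x)) +
    Rintegral surf GamN (fun x => mdot (g x) (gd_trace v x)).

Let L2grad (v : D) : L2 leb Omega (gd_grad v) := gd_grad_L2 v.
Let L2rec (v : D) : L2 leb Omega (gd_rec v) := gd_rec_L2 v.

Lemma gd_normE (v : D) : gd_norm v = (nrm (gd_grad v))%:E.
Proof. exact: L2norm_L2dot. Qed.

(** A discrete Poincaré inequality, read off from [gd_C]. *)
Lemma gd_rec_le (v : D) : nrm (gd_rec v) <= CP * nrm (gd_grad v).
Proof.
have [v0|v0] := pselect (v = 0).
  (* The supremum omits [v = 0]; almost everywhere linearity applied to [(-1) *: 0 + 0] shows that
     this representative vanishes up to a null set. *)
  have rv0 : {ae leb, forall x, Omega x -> gd_rec v x = 0}.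
    apply: ae_imply (gd_rec_linear (-1) v v) => x.
    by rewrite v0 scaler0 addr0 scaleN1r addNr.
  have z2 : mfield (Omega : set (caratheodory_type (leb_om R n))) (fun=> 0 : Rd).
    by move=> i j; exact: measurable_cst.
  have m2 := (L2rec v).1.
  rewrite (eq_L2dot_ae mO m2 z2 m2 z2 rv0 rv0) /L2dot.
  under eq_Rintegral do rewrite mdot0l.
  by rewrite /Rintegral integral0 sqrtr0 mulr_ge0 ?sqrtr_ge0// ltW.
have [CD _] := gd_CK_le coerD.
apply: lee_div_EFin; rewrite ?sqrtr_ge0//.
rewrite -gd_normE -(L2norm_L2dot mO (L2rec v)); apply: le_trans CD.
by apply: le_trans (le_gd_max _ v0); rewrite le_max lexx.
Qed.

(** A discrete Korn inequality, read off from [gd_K]. *)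
Lemma gd_grad_le_strain (v : D) :
  nrm (gd_grad v) <= CP * nrm (strain (gd_grad v)).
Proof.
have [v0|v0] := pselect (v = 0).
  have : gd_norm v = 0%E by rewrite v0 gd_norm0.
  rewrite gd_normE => -[->].
  by rewrite mulr_ge0 ?sqrtr_ge0// ltW.
have [_ KD] := gd_CK_le coerD.
apply: lee_div_EFin; rewrite ?sqrtr_ge0//.
rewrite -gd_normE -(L2norm_L2dot mO (L2_strain (L2grad v)).1).
by apply: le_trans KD; exact: (le_gd_max _ v0).
Qed.

(** The scheme replaces the discrete elastic form by the load terms; with [- F] as divergence and
    [g] as normal trace, the left-hand side becomes the numerator of [gd_W]. *)
Lemma conformity_le (w : R) (v : D) : v <> 0 ->
  (gd_W D (stress Gubar) (fun x => - F x)%R g <= w%:E)%E ->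
  `|L2dotO (gd_grad v) (stress Gubar) - L2dotO (stress (gd_grad u)) (strain (gd_grad v))|
  <= w * nrm (gd_grad v).
Proof.
move=> v0 Ww.
have [s2 _] := L2_stress Gubar2.
have NF2 := L2N mO F2.
rewrite [X in _ - X]/L2dot scheme.
rewrite opprD addrA -[X in _ - X - _]/(L2dotO F (gd_rec v)) -(L2dotNl mO F2 (L2rec v)).
rewrite (L2dotC leb Omega (fun x : Rd => - F x)) /L2dot -RintegralD; last 3 first.
- exact: mO.
- exact: (integrable_mdot mO (L2grad v) s2).
- exact: (integrable_mdot mO (L2rec v) NF2).
apply: lee_div_EFin; rewrite ?sqrtr_ge0//.
rewrite -gd_normE; apply: le_trans Ww.
exact: (le_gd_max _ v0).
Qed.

(** [M] bounds the norm of [v0 - u]: the energy bound gives the factor [sigma_lo^-1], and the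
    discrete Korn inequality, squared, gives [CP ^+ 2]. *)
Lemma scheme_error (v0 : D) (s w : R) : 
  (gd_W D (stress Gubar) (fun x => - F x)%R g <= w%:E)%E ->
  (L2norm leb Omega (fun x => gd_rec v0 x - ubar x)%R +
   L2norm leb Omega (fun x => gd_grad v0 x - Gubar x)%R <= s%:E)%E ->
  let M := CP ^+ 2 / sigma_lo * (w + sigma_up * s) in
  (L2norm leb Omega (fun x => gd_rec u x - ubar x)%R <= (s + CP * M)%:E)%E /\
  (L2norm leb Omega (fun x => gd_grad u x - Gubar x)%R <= (s + M)%:E)%E.
Proof.
move=> Ww Ss M.
have dr2 := L2B mO (L2rec v0) ubar2.
have dg2 := L2B mO (L2grad v0) Gubar2.
move: Ss; rewrite (L2norm_L2dot mO dr2) (L2norm_L2dot mO dg2) -EFinD lee_fin => Ss.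
set dr := fun x => gd_rec v0 x - ubar x in dr2 Ss.
set dg := fun x => gd_grad v0 x - Gubar x in dg2 Ss.
have sr : nrm dr <= s by apply: le_trans Ss; rewrite lerDl sqrtr_ge0.
have sg : nrm dg <= s by apply: le_trans Ss; rewrite lerDr sqrtr_ge0.
(* The difference [v0 - u], in the shape to which [ae_linear] applies. *)
pose v : D := (-1) *: u + v0.
have gv : {ae leb, forall x, Omega x ->
    gd_grad v x = dg x - (gd_grad u x - Gubar x)}.
  apply: ae_imply (gd_grad_linear (-1) u v0) => x ->.
  by rewrite /dg scaleN1r opprB addrA subrK addrC.
have rv : {ae leb, forall x, Omega x ->
    gd_rec v x = dr x - (gd_rec u x - ubar x)}.
  apply: ae_imply (gd_rec_linear (-1) u v0) => x ->.
  by rewrite /dr scaleN1r opprB addrA subrK addrC.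
have [s2 _] := L2_stress Gubar2.
have [su2 _] := L2_stress (L2grad u).
have [sdg2 sdgle] := L2_stress dg2.
have [sv2 _] := L2_stress (L2grad v).
have [ev2 evle] := L2_strain (L2grad v).
pose N := nrm (gd_grad v); pose E := nrm (strain (gd_grad v)).
have N0 : 0 <= N by exact: sqrtr_ge0.
have NE : N <= CP * E by exact: gd_grad_le_strain.
(* The first summand is the interpolation error, controlled by [s]; the second is the conformity
   error, controlled by [w]. *)
have split_stress : {ae leb, forall x, Omega x -> stress (gd_grad v) x =
    stress dg x + (stress Gubar x - stress (gd_grad u) x)}.
  apply: ae_imply gv => x gvx.
  by rewrite /stress gvx !sympartB !tappB opprB addrA.
have s0 : 0 <= s by apply: le_trans sr; exact: sqrtr_ge0.
have w0 : 0 <= w by rewrite -lee_fin; apply: le_trans Ww; exact: gd_max_ge0.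
have M0 : 0 <= M.
  by rewrite mulr_ge0 ?divr_ge0 ?sqr_ge0 ?addr_ge0 ?mulr_ge0 ?(ltW slo0) ?(ltW sup0).
have NM : N <= M.
  have [v_eq0|v_neq0] := pselect (v = 0).
    have : gd_norm v = 0%E by rewrite v_eq0 gd_norm0.
    by rewrite gd_normE /N => -[->].
  have energy : sigma_lo * E ^+ 2 <= (sigma_up * s + w) * N.
    rewrite sqr_sqrtr; last exact: L2dot_ge0.
    apply: le_trans (stress_coercive (L2grad v)) _.
    have sd2 := L2B mO s2 su2; have [msum _] := L2D mO sdg2 sd2.
    rewrite (eq_L2dot_ae mO sv2.1 msum ev2.1 ev2.1 split_stress (aeW _ _)); last by [].
    rewrite (L2dotDl mO sdg2 sd2 ev2) (L2dotBl mO s2 su2 ev2).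
    rewrite (L2dot_stress Gubar2 (L2grad v)).
    rewrite (L2dotC leb Omega (stress Gubar)) mulrDl lerD//.
      apply: le_trans (ler_norm _) _.
      apply: le_trans (cauchy_schwarz mO sdg2 ev2) _.
      apply: ler_pM; [exact: sqrtr_ge0|exact: sqrtr_ge0| |exact: evle].
      by apply: (le_trans sdgle); rewrite ler_wpM2l// ltW.
    by apply: le_trans (ler_norm _) _; exact: conformity_le.
  (* For [N > 0], the energy bound multiplied by [CP ^+ 2] dominates [sigma_lo * N ^+ 2], and one
     factor [N] cancels. *)
  have [->//|Nn0] := eqVneq N 0; have Npos : 0 < N by rewrite lt_def Nn0.
  rewrite /M mulrAC ler_pdivlMr// -(ler_pM2r Npos) mulrAC.
  have N2 : N * N <= CP ^+ 2 * E ^+ 2.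
    by rewrite -expr2 -exprMn ler_pXn2r ?nnegrE ?mulr_ge0 ?sqrtr_ge0// ltW.
  apply: (le_trans (ler_wpM2r (ltW slo0) N2)).
  have := ler_wpM2l (sqr_ge0 CP) energy; congr (_ <= _); ring.
have a2 := L2B mO (L2rec u) ubar2; have b2 := L2B mO (L2grad u) Gubar2.
rewrite (L2norm_L2dot mO a2) (L2norm_L2dot mO b2) !lee_fin; split.
  have rv' : {ae leb, forall x, Omega x ->
      gd_rec u x - ubar x = dr x - gd_rec v x}.
    by apply: ae_imply rv => x ->; rewrite opprB addrCA subrr addr0.
  apply: le_trans (L2dot_triangle_ae mO a2 dr2 (L2rec v) rv') _.
  rewrite lerD//; apply: (le_trans (gd_rec_le v)).
  by rewrite ler_wpM2l// ltW.
have gv' : {ae leb, forall x, Omega x ->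
    gd_grad u x - Gubar x = dg x - gd_grad v x}.
  by apply: ae_imply gv => x ->; rewrite opprB addrCA subrr addr0.
by apply: le_trans (L2dot_triangle_ae mO b2 dg2 (L2grad v) gv') _; rewrite lerD.
Qed.

End Elasticity.

(** * Convergence along the sequence of Gradient Schemes *)

Theorem corollary3p3 (R : realType) (n : nat)
    (Omega GamD GamN : set 'rV[R]_n.+1)
    (F g : 'rV[R]_n.+1 -> 'rV[R]_n.+1)
    (C : 'rV[R]_n.+1 -> tensor4 R n.+1) (sigma_up sigma_lo : R)
    (ubar : 'rV[R]_n.+1 -> 'rV[R]_n.+1) (Gubar : 'rV[R]_n.+1 -> 'M[R]_n.+1)
    (tubar : 'rV[R]_n.+1 -> 'rV[R]_n.+1)
    (D : nat -> grad_disc Omega GamN) (u : forall m, D m) :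
  connected Omega -> open Omega -> lipschitz_boundary Omega ->
  measurable (GamD : set (caratheodory_type (surf_om R n))) ->
  measurable (GamN : set (caratheodory_type (surf_om R n))) ->
  GamD `&` GamN = set0 -> bdry Omega = GamD `|` GamN ->
  (0 < surf R n GamD)%E ->
  L2 (leb R n) Omega F ->
  L2 (surf R n) GamN g ->
  (forall i j k l, measurable_fun (Omega : set (caratheodory_type (leb_om R n)))
                     (fun x => C x i j k l)) ->
  0 < sigma_up -> 0 < sigma_lo ->
  {ae leb R n, forall x, Omega x -> forall tau omega : 'M[R]_n.+1,
    [/\ mdot (tapp (C x) tau) omega = mdot tau (tapp (C x) omega),
        (tapp (C x) tau)^T = tapp (C x) tau^T,
        (opnorm (C x) <= sigma_up%:E)%E &
        sigma_lo * mnorm tau ^+ 2 <= mdot (tapp (C x) tau) tau]} ->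
  H1_0 Omega GamD ubar Gubar tubar ->
  (forall v Gv tv, H1_0 Omega GamD v Gv tv ->
    Rintegral (leb R n) Omega
      (fun x => mdot (tapp (C x) (sympart (Gubar x))) (sympart (Gv x))) =
    Rintegral (leb R n) Omega (fun x => mdot (F x) (v x)) +
    Rintegral (surf R n) GamN (fun x => mdot (g x) (tv x))) ->
  consistent GamD D -> limit_conforming D -> coercive D ->
  (forall m (v : D m),
    Rintegral (leb R n) Omega
      (fun x => mdot (tapp (C x) (gd_strain (u m) x)) (gd_strain v x)) =
    Rintegral (leb R n) Omega (fun x => mdot (F x) (gd_rec v x)) +
    Rintegral (surf R n) GamN (fun x => mdot (g x) (gd_trace v x))) ->
  (fun m => L2norm (leb R n) Omega (fun x => gd_rec (u m) x - ubar x))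
    @ \oo --> 0%E /\
  (fun m => L2norm (leb R n) Omega (fun x => gd_grad (u m) x - Gubar x))
    @ \oo --> 0%E.
Proof.
move=> _ oO _ _ _ DN0 bDN _ F2 g2 mC sup0 slo0 aeC ubarH weak cons conf coer.
move=> scheme.
have [[ubar2 Gubar2 _] _ _] := ubarH.
have Ht := stress_Hdiv oO mC sup0 aeC F2 g2 DN0 bDN ubarH weak.
have W0 := conf _ _ _ Ht.
have S0 := cons _ _ _ ubarH.
have [CP [CP0 coerCP]] := coer.
(* With [s = w = d], the bound [M] of [scheme_error] equals [d * K]. *)
pose K := CP ^+ 2 / sigma_lo * (1 + sigma_up).
have K0 : 0 <= K by rewrite mulr_ge0 ?divr_ge0 ?sqr_ge0 ?addr_ge0// ltW.
have err (d : R) : 0 < d -> \forall m \near \oo,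
    (L2norm (leb R n) Omega (fun x => gd_rec (u m) x - ubar x)%R <=
      (d * (1 + CP * K))%:E)%E /\
    (L2norm (leb R n) Omega (fun x => gd_grad (u m) x - Gubar x)%R <=
      (d * (1 + K))%:E)%E.
  move=> d0; have Wd := near_lt_EFin d0 W0; have Sd := near_lt_EFin d0 S0.
  near=> m.
  have /ltW Wm : (gd_W (D m) (stress C Gubar) (fun x => - F x)%R g < d%:E)%E.
    by near: m.
  have : (gd_S (D m) ubar Gubar < d%:E)%E by near: m.
  (* The strict inequality for the infimum provides an interpolant [v0] with error below [d]. *)
  move=> /ereal_inf_lt[_ [v0 _ <-] /ltW v0d].
  have [e1 e2] := scheme_error oO mC sup0 slo0 aeC F2 ubar2 Gubar2 CP0
    (coerCP m) (scheme m) Wm v0d.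
  split; [apply: le_trans e1 _|apply: le_trans e2 _];
    rewrite lee_fin le_eqVlt /K; apply/orP; left; apply/eqP; ring.
have L2norm_ge0 p q (f : 'rV[R]_n.+1 -> 'M[R]_(p, q)) :
  (0 <= L2norm (leb R n) Omega f)%E by exact: Lnorm_ge0.
split; apply: cvge0_le => // e e0.
- have q0 : 0 < 1 + CP * K by rewrite ltr_pwDl// mulr_ge0// ltW.
  (* The choice [d = e / (1 + CP * K)] makes the final bound exactly [e]. *)
  apply: filterS (err _ (divr_gt0 e0 q0)) => m [+ _].
  by rewrite divfK// gt_eqF.
- have q0 : 0 < 1 + K by rewrite ltr_pwDl.
  apply: filterS (err _ (divr_gt0 e0 q0)) => m [_].
  by rewrite divfK// gt_eqF.
Unshelve. all: by end_near.
Qed.
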